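(* Let $M$ be the model class and $K_A$ the limiting spectral measure defined in the context. Let $(\beta_n)$ be a sequence of positive numbers. Suppose that an estimator $\hat K=\hat K(X^{(1)},\dots,X^{(n)})$ (a probability measure on $\aleph_+^1$ depending on the sample) satisfies $$\liminf_{n\to\infty}\ \inf_{\mathcal{L}(X)\in M}P\big(\mathbb{W}_p^p(\hat K,K_A)\le\beta_n^p\big)=1 .$$ Then $$\liminf_{n\to\infty}\ n^s\beta_n^p>0 .$$
   Context: Constants: integers $m\ge d\ge 2$, $\alpha\in(0,\infty)$, $p\in[1,\infty)$, $0<l<1<u$, $\sigma>0$, $0<s<\frac12$, $0<\xi<1$, $\zeta>0$ are fixed. $\mathbb{R}_+=[0,\infty)$; $\|\cdot\|_1$ is the $\ell_1$-norm; $A_{\cdot i}$ is the $i$-th column of $A$; $JA=\sqrt{|\det(AA^\top)|}$ for $A\in\mathbb{R}^{d\times m}$. $\mathcal{L}(X)$ is the law of $X$. Model class. $\mathcal{A}=\{A\in\mathbb{R}_+^{d\times m}: l\le\min_i\|A_{\cdot i}\|_1\le\max_i\|A_{\cdot i}\|_1\le u,\ JA\ge\sigma\}$. For each integer $k\ge1$, $\tilde M_k$ is the set of laws of random vectors $Z$ in $\mathbb{R}_+^m$ admitting a Lebesgue density $g$ on $\mathbb{R}_+^m$ such that (a) for all $z$, $\left|\frac{g(z)-\alpha^m\prod_{i=1}^m(1+z_i)^{-(\alpha+1)}}{\alpha^m\prod_{i=1}^m(1+z_i)^{-(\alpha+1)}}\right|\le\xi k^{-s}$, and (b) $g(z)\propto\prod_{i=1}^m(1+z_i)^{-(\alpha+1)}$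 on $\{z:\|z\|_1>\zeta k^{\frac{1-2s}{\alpha}}\}$ (i.e. equality up to a multiplicative constant on this set). $M_k=\{\mathcal{L}(X):X=AZ,\ A\in\mathcal{A},\ \mathcal{L}(Z)\in\tilde M_k\}$ and $M=\bigcup_{k=1}^\infty M_k$. For $\mathcal{L}(X)\in M$, $A$ denotes the matrix in the representation $X=AZ$, and $P$ is the probability when $X^{(1)},\dots,X^{(n)}$ are i.i.d. with law $\mathcal{L}(X)$. Spectral measure. $K_A=\sum_{i=1}^m\frac{\|A_{\cdot i}\|_1^\alpha}{\sum_{j=1}^m\|A_{\cdot j}\|_1^\alpha}\,\delta_{A_{\cdot i}/\|A_{\cdot i}\|_1}$, a probability measure on $\aleph_+^1=\{\omega\in\mathbb{R}_+^d:\|\omega\|_1=1\}$. Wasserstein distance. For probability measures $\mu,\mu'$ on $\aleph_+^1$, $\mathbb{W}_p(\mu,\mu')=\big(\inf_{\gamma}E_{(y,y')\sim\gamma}[\|y-y'\|_1^p]\big)^{1/p}$, the infimum over all couplings $\gamma$ of $\mu$ and $\mu'$; $\mathbb{W}_p^p$ is its $p$-th power.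
   Formalization: It is additionally assumed that some A in the class 𝒜 has JA > σ strictly; at the extremal σ the claim fails (m=d=2, σ=u²: 𝒜 is uI and its column swap, with the same K_A, so a constant estimator is exact), and for larger σ the class M is empty. *)

(* Defs.v *)
From HB Require Import structures.
From mathcomp Require Import all_boot all_order all_algebra.
From mathcomp Require Import all_classical all_reals all_analysis.
From mathcomp Require Import measurable_realfun.

Set Implicit Arguments.
Unset Strict Implicit.
Unset Printing Implicit Defensive.
Import Order.TTheory GRing.Theory Num.Theory.
Import numFieldNormedType.Exports.

Local Open Scope classical_set_scope.
Local Open Scope ring_scope.

(* Finite powers of a sigma-finite measure on [n.-tuple T]: used both for the
   Lebesgue measure on R^m and for the law of an i.i.d. sample. *)

Section cons_measure.
Context d (T : measurableType d) (R : realType) (n : nat).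
Variables (m1 : {sigma_finite_measure set T -> \bar R})
          (m2 : {sigma_finite_measure set (n.-tuple T) -> \bar R}).
Local Open Scope ereal_scope.

Definition cons_pair (x : T * n.-tuple T) : n.+1.-tuple T :=
  [the n.+1.-tuple T of x.1 :: x.2].

Lemma measurable_cons_pair : measurable_fun setT cons_pair.
Proof. exact: measurable_cons. Qed.

Definition cons_measure : set (n.+1.-tuple T) -> \bar R :=
  pushforward (m1 \x m2) cons_pair.

Let cons_measure0 : cons_measure set0 = 0.
Proof. by rewrite /cons_measure /pushforward preimage_set0 measure0. Qed.

Let cons_measure_ge0 A : 0 <= cons_measure A.
Proof. by rewrite /cons_measure /pushforward measure_ge0. Qed.

Let cons_measure_sigma_additive : semi_sigma_additive cons_measure.
Proof.
move=> F mF tF mUF; rewrite /cons_measure /pushforward preimage_bigcup.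
apply: measure_semi_sigma_additive.
- by move=> k; rewrite -[X in measurable X]setTI; exact: measurable_cons_pair.
- apply/trivIsetP => /= i j _ _ ij; rewrite -preimage_setI.
  by move/trivIsetP : tF => /(_ _ _ _ _ ij) ->//; rewrite preimage_set0.
- rewrite -preimage_bigcup -[X in measurable X]setTI.
  exact: measurable_cons_pair.
Qed.

HB.instance Definition _ := isMeasure.Build _ _ _ cons_measure
  cons_measure0 cons_measure_ge0 cons_measure_sigma_additive.

Let cons_measure_sigma_finite : sigma_finite setT cons_measure.
Proof.
have /sigma_finiteP[F [TF ndF Foo]] := sigma_finiteT m1.
have /sigma_finiteP[G [TG ndG Goo]] := sigma_finiteT m2.
pose unc (t : n.+1.-tuple T) : T * n.-tuple T :=
  (tnth t ord0, [tuple of behead t]).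
have munc : measurable_fun setT unc.
  apply/measurable_fun_pairP; split.
    exact: measurable_tnth.
  exact: measurable_behead.
have consK x : unc (cons_pair x) = x.
  by case: x => a t; congr pair; exact: val_inj.
exists (fun k => unc @^-1` (F k `*` G k)).
  rewrite -preimage_bigcup (_ : \bigcup_k _ = setT) ?preimage_setT//.
  rewrite -setXTT TF TG predeqE => -[x y]; split.
    by move=> [k _ []/= ? ?]; split; exists k.
  move=> [/= [a _ Fax] [b _ Gby]]; exists (maxn a b) => //; split.
  - by move: x Fax; exact/subsetPset/ndF/leq_maxl.
  - by move: y Gby; exact/subsetPset/ndG/leq_maxr.
move=> k; have [mF Fk] := Foo k; have [mG Gk] := Goo k; split.
  by rewrite -[X in measurable X]setTI; apply: munc => //; exact: measurableX.
rewrite /cons_measure /pushforward.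
rewrite (_ : cons_pair @^-1` _ = F k `*` G k); last first.
  by apply/funext => x; rewrite {1}/preimage /mkset {1}/preimage /mkset consK.
by rewrite product_measure1E// lte_mul_pinfty// ge0_fin_numE.
Qed.

HB.instance Definition _ := Measure_isSigmaFinite.Build _ _ _ cons_measure
  cons_measure_sigma_finite.

End cons_measure.

Fixpoint power_measure d (T : measurableType d) (R : realType)
    (mu : {sigma_finite_measure set T -> \bar R}) (n : nat) :
    {sigma_finite_measure set (n.-tuple T) -> \bar R} :=
  match n with
  | 0%N => [the {sigma_finite_measure set (0.-tuple T) -> \bar R} of
              \d_([tuple] : 0.-tuple T)]
  | n'.+1 => [the {sigma_finite_measure set (n'.+1.-tuple T) -> \bar R} of
              cons_measure mu (power_measure mu n')]
  end.

Lemma power_measure_box d (T : measurableType d) (R : realType)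
    (mu : {sigma_finite_measure set T -> \bar R}) (n : nat)
    (B : 'I_n -> set T) : (forall i, measurable (B i)) ->
  power_measure mu n [set t | forall i, B i (tnth t i)] =
  (\prod_(i < n) mu (B i))%E.
Proof.
elim: n B => [|n IH] B mB /=.
  rewrite big_ord0 diracE (_ : [set _ | _] = setT) ?in_setT//.
  by apply/seteqP; split => // t _ [].
rewrite big_ord_recl /cons_measure /pushforward -IH; last by move=> i; exact: mB.
rewrite -product_measure1E//; last first.
  rewrite (_ : [set _ | _] = \bigcap_(i in [set: 'I_n])
      ((fun t : n.-tuple T => tnth t i) @^-1` B (lift ord0 i))).
    apply: fin_bigcap_measurable => // i _.
    by rewrite -[X in measurable X]setTI; exact: measurable_tnth.
  by apply/seteqP; split => t /= H i; [move=> _; exact: H|exact: H].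
congr (_ _); apply/seteqP; split => -[a t] /= H.
  split; first exact: (H ord0).
  by move=> i; have := H (lift ord0 i); rewrite tnthS.
move=> i; have [->|] := eqVneq i ord0; first exact: H.1.
case: (unliftP ord0 i) => [j ->|->]; last by rewrite eqxx.
by move=> _; rewrite tnthS; exact: H.2.
Qed.

(* [measurableTypeR R] is R with its Borel sets, under the display for which
   the library's [lebesgue_measure] is a measure. *)
Notation "''V[' R ]_ n" := (n.-tuple (measurableTypeR R))
  (at level 0, n at level 2, format "''V[' R ]_ n") : type_scope.

Section vectors.
Context (R : realType).

Definition l1norm n (x : 'V[R]_n) : R := \sum_(i < n) `|tnth x i|.

Definition l1dist n (x y : 'V[R]_n) : R :=
  \sum_(i < n) `|tnth x i - tnth y i|.

Definition orthant n : set 'V[R]_n :=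
  [set x | forall i, 0 <= tnth x i].

Definition simplex n : set 'V[R]_n :=
  [set x | orthant x /\ l1norm x = 1].

Definition lebesgue_tuple n : {sigma_finite_measure set 'V[R]_n -> \bar R} :=
  power_measure lebesgue_measure n.

Definition mx_col d m (A : 'M[R]_(d, m)) (j : 'I_m) : 'V[R]_d :=
  [tuple A i j | i < d].

Definition mx_act d m (A : 'M[R]_(d, m)) (z : 'V[R]_m) : 'V[R]_d :=
  [tuple (A *m \col_j tnth z j) i 0 | i < d].

Lemma measurable_mx_act d m (A : 'M[R]_(d, m)) :
  measurable_fun setT (mx_act A).
Proof.
apply/measurable_fun_tnthP => i.
rewrite (_ : _ \o _ = fun z => \sum_(j < m) A i j * tnth z j); last first.
  apply/funext => z /=; rewrite tnth_mktuple mxE.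
  by apply: eq_bigr => j _; rewrite mxE.
apply: measurable_sum => j; apply: measurable_funM => //.
exact: measurable_tnth.
Qed.

HB.instance Definition _ d m (A : 'M[R]_(d, m)) :=
  isMeasurableFun.Build _ _ _ _ (mx_act A) (measurable_mx_act A).

Definition JA d m (A : 'M[R]_(d, m)) : R := Num.sqrt `|\det (A *m A^T)|.

End vectors.

Section model.
Context (R : realType).

Definition coef_class d m (l u sigma : R) : set 'M[R]_(d, m) :=
  [set A : 'M[R]_(d, m) | [/\ forall i j, 0 <= A i j,
               forall j, l <= l1norm (mx_col A j) <= u &
               sigma <= JA A]].

Definition pareto_shape m (alpha : R) (z : 'V[R]_m) : R :=
  \prod_(i < m) (1 + tnth z i) `^ (- (alpha + 1)).

Definition pareto_density m (alpha : R) (z : 'V[R]_m) : R :=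
  alpha ^+ m * pareto_shape alpha z.

(* Only the values of g on the orthant matter; the relative-error bound makes them positive
   when k >= 1 and xi < 1, so g need not be assumed nonnegative. *)
Definition noise_class m (alpha s xi zeta : R) (k : nat) :
    set (probability 'V[R]_m R) :=
  [set Q | exists g : 'V[R]_m -> R,
    [/\ measurable_fun (@orthant R m) g,
        forall B, measurable B ->
          Q B = (\int[lebesgue_tuple R m]_(z in B `&` @orthant R m) (g z)%:E)%E,
        forall z, orthant z ->
          `|(g z - pareto_density alpha z) / pareto_density alpha z|
            <= xi * k%:R `^ (- s) &
        exists c : R, forall z, orthant z ->
          zeta * k%:R `^ ((1 - 2 * s) / alpha) < l1norm z ->
          g z = c * pareto_shape alpha z]].

Definition law d m (A : 'M[R]_(d, m)) (Q : probability 'V[R]_m R) :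
    probability 'V[R]_d R :=
  distribution Q (mx_act A).

(* A law L(AZ) of the model is recorded by a pair (A, L(Z)) representing it,
   so that the matrix A to which K_A refers stays available. *)
Definition model d m (alpha l u sigma s xi zeta : R) :
    set ('M[R]_(d, m) * probability 'V[R]_m R) :=
  \bigcup_(k in [set k | (0 < k)%N])
    (@coef_class d m l u sigma `*` @noise_class m alpha s xi zeta k).

End model.

Section spectral_measure.
Context (R : realType) (d m : nat) (alpha : R) (A : 'M[R]_(d, m)).
Local Open Scope ereal_scope.

Definition spectral_weight (j : 'I_m) : R :=
  (l1norm (mx_col A j) `^ alpha /
   \sum_(i < m) l1norm (mx_col A i) `^ alpha)%R.

Definition spectral_atom (j : 'I_m) : 'V[R]_d :=
  [tuple (A i j / l1norm (mx_col A j))%R | i < d].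

Definition spectral_measure (B : set 'V[R]_d) : \bar R :=
  \sum_(j < m) (spectral_weight j)%:E * \d_(spectral_atom j) B.

Lemma spectral_weight_ge0 j : (0 <= spectral_weight j)%R.
Proof.
by rewrite divr_ge0 ?powR_ge0// sumr_ge0// => i _; exact: powR_ge0.
Qed.

Let term_ge0 j B : 0 <= (spectral_weight j)%:E * \d_(spectral_atom j) B.
Proof. by rewrite mule_ge0// lee_fin spectral_weight_ge0. Qed.

Let spectral_measure0 : spectral_measure set0 = 0.
Proof.
by rewrite /spectral_measure big1// => j _; rewrite measure0 mule0.
Qed.

Let spectral_measure_ge0 B : 0 <= spectral_measure B.
Proof. by apply: sume_ge0 => j _; exact: term_ge0. Qed.

Let spectral_measure_sigma_additive : semi_sigma_additive spectral_measure.
Proof.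
move=> F mF tF mUF; rewrite [X in _ --> X](_ : _ =
    lim ((fun n => \sum_(0 <= i < n) spectral_measure (F i))%E @ \oo)).
  by apply: is_cvg_ereal_nneg_natsum => k _; exact: spectral_measure_ge0.
rewrite nneseries_sum//; apply: eq_bigr => /= j _.
by rewrite measure_semi_bigcup// nneseriesZl.
Qed.

HB.instance Definition _ := isMeasure.Build _ _ _ spectral_measure
  spectral_measure0 spectral_measure_ge0 spectral_measure_sigma_additive.

End spectral_measure.

Lemma spectral_measure_simplex (R : realType) (d m : nat)
    (alpha l u sigma : R) (A : 'M[R]_(d, m)) :
  (0 < m)%N -> 0 < l -> coef_class l u sigma A ->
  spectral_measure alpha A (@simplex R d) = 1%E.
Proof.
move=> m0 l0 [A0 Al _].
have np j : 0 < l1norm (mx_col A j).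
  by rewrite (lt_le_trans l0)//; case/andP: (Al j).
have sA j : simplex (spectral_atom A j).
  split=> [i|]; first by rewrite tnth_mktuple divr_ge0// ltW.
  rewrite -[RHS](divff (lt0r_neq0 (np j))) {2}/l1norm mulr_suml /l1norm.
  apply: eq_bigr => i _.
  by rewrite !tnth_mktuple normrM normfV ger0_norm// ger0_norm// ltW.
rewrite /spectral_measure.
under eq_bigr => j _ do rewrite diracE (mem_set (sA j)) mule1.
rewrite sumEFin -mulr_suml divff// gt_eqF//.
case: m m0 A A0 Al np sA => // m _ A _ _ np _.
by rewrite big_ord_recl ltr_pwDl ?powR_gt0// sumr_ge0// => i _; exact: powR_ge0.
Qed.

Section wasserstein.
Context (R : realType) (d : nat).
Local Open Scope ereal_scope.

Definition coupling (mu nu : set 'V[R]_d -> \bar R) :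
    set (probability ('V[R]_d * 'V[R]_d)%type R) :=
  [set gamma | forall B, measurable B ->
     gamma (B `*` setT) = mu B /\ gamma (setT `*` B) = nu B].

Definition wasserstein (p : R) (mu nu : set 'V[R]_d -> \bar R) : \bar R :=
  (ereal_inf [set \int[gamma]_y (l1dist y.1 y.2 `^ p)%:E
             | gamma in coupling mu nu]) `^ p^-1.

End wasserstein.

(* The event W_p^p(Khat, K_A) <= b^p in the space of samples of size n. *)
Definition success (R : realType) (d m n : nat) (alpha p b : R)
    (Khat : n.-tuple 'V[R]_d -> probability 'V[R]_d R)
    (A : 'M[R]_(d, m)) : set (n.-tuple 'V[R]_d) :=
  [set x | (wasserstein p (Khat x) (spectral_measure alpha A) `^ p
              <= (b `^ p)%:E)%E].

(* Main.v *)
Require Import Defs.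
From HB Require Import structures.
From mathcomp Require Import all_boot all_order all_algebra.
From mathcomp Require Import all_classical all_reals all_analysis.
From mathcomp Require Import measurable_realfun ring lra.

Import Order.TTheory GRing.Theory Num.Theory.
Import numFieldNormedType.Exports.
Local Open Scope classical_set_scope.
Local Open Scope ring_scope.

(** The rate is forced by two laws of the model that n observations cannot
    tell apart although no estimate is within cost o(n^(-s)), in the sense of
    W_p^p, of both spectral measures.

    Fix an admissible matrix A with JA A > sigma and a column j whose direction
    w is not shared by all columns; there is one because A has rank d >= 2.
    Multiplying column j by exp(theta) moves no atom of the spectral measure
    but changes the mass at w by an amount of order theta
    ([perturbed_ratio_gap]).  In a coupling of two measures, mass that
    leaves a ball around w for the outside of a larger ball travels at least
    the difference of the radii ([transport_markov]), so one and the same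
    estimate cannot be within cost b of both spectral measures unless
    b >= g |theta| ([spectral_gap]).  Working with the mass of balls gives this
    bound directly for the p-th power of the distance, without the triangle
    inequality and the gluing of couplings behind it.

    On the other side, take Z with independent Pareto coordinates.  The law of
    exp(theta) Z_j is absolutely continuous with respect to that of Z_j, with
    density ratio 1 + O(theta) ([scale_weight_close]).  So the noise Z can be
    given a density with relative perturbation O(theta) which cancels the change
    of the matrix completely, but the model allows this only in a region of
    radius of order k^((1 - 2 s) / alpha); outside, the density has to stay
    proportional to the Pareto density ([exists_tilt]).  The two laws of X thus
    differ only in the tail, of mass O(k^(-(1 - 2 s))), by a factor
    1 + O(theta).  With theta of order k^(-s) their chi-square distance is
    O(k^(- 2 s) k^(-(1 - 2 s))) = O(1 / k), hence bounded for n = k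
    observations ([exists_dominated_pair], [tail_constant_le]).

    The chi-square bound enters as the inequality
    (int F dmu)^2 <= C int F^2 dnu for all F >= 0, which passes to images and to
    products with constant C^n ([l2_dominated_power]).  For n observations the
    constant is at most exp K, whatever n.  If both success events had
    probability 1 - eta with eta small and were disjoint, the inequality applied
    to the indicator of one of them would fail ([l2_dominated_two_point]).  So
    they meet, and beta_n^p >= g |theta|, which is of order n^(-s). *)

(** * Integration over finite powers of a measure *)

Section power_measure_integral.
Context {d} {T : measurableType d} {R : realType}.
Local Open Scope ereal_scope.
Implicit Types mu nu : {sigma_finite_measure set T -> \bar R}.

Lemma measurable_fun_cons_pair n (F : n.+1.-tuple T -> \bar R) (a : T) :
  measurable_fun [set: n.+1.-tuple T] F ->
  measurable_fun [set: n.-tuple T] (fun t => F (cons_pair (a, t))).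
Proof.
move=> mF; apply: (measurableT_comp mF).
exact: (measurable_cons (measurable_cst a) (@measurable_id _ _ setT)).
Qed.

Lemma integral_power_measureS mu n (F : n.+1.-tuple T -> \bar R) :
  measurable_fun [set: n.+1.-tuple T] F -> (forall t, 0 <= F t) ->
  \int[power_measure mu n.+1]_t F t =
  \int[mu]_a \int[power_measure mu n]_t F (cons_pair (a, t)).
Proof.
move=> mF F0 /=; rewrite /cons_measure.
rewrite ge0_integral_pushforward//=; last exact: measurable_cons_pair.
rewrite preimage_setT fubini_tonelli1//=.
by apply: (measurableT_comp mF); exact: measurable_cons_pair.
Qed.

Lemma measurable_integral_cons mu n (F : n.+1.-tuple T -> \bar R) :
  measurable_fun [set: n.+1.-tuple T] F -> (forall t, 0 <= F t) ->
  measurable_fun setT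
    (fun a => \int[power_measure mu n]_t F (cons_pair (a, t))).
Proof.
move=> mF F0.
have mFc : measurable_fun setT (F \o @cons_pair _ T n).
  by apply: (measurableT_comp mF); exact: measurable_cons_pair.
have Fc0 x : 0 <= (F \o @cons_pair _ T n) x by exact: F0.
exact: (measurable_fun_fubini_tonelli_F (m2 := power_measure mu n) _ mFc Fc0).
Qed.

Lemma integral_power_measure0 mu (F : 0.-tuple T -> \bar R) :
  measurable_fun [set: 0.-tuple T] F ->
  \int[power_measure mu 0]_t F t = F [tuple].
Proof. by move=> mF /=; rewrite integral_dirac// diracT mul1e. Qed.

End power_measure_integral.

(** * Chi-square domination of one measure by another *)

Section l2_domination.
Context {R : realType}.
Local Open Scope ereal_scope.

(** When mu has a density h with respect to nu, the least such C is
    int h^2 dnu, that is one plus the chi-square divergence.  Quantifying over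
    F instead of naming h makes images and products immediate. *)
Definition l2_dominated {d} {T : measurableType d} (C : R)
    (mu nu : {measure set T -> \bar R}) :=
  forall F : T -> \bar R, measurable_fun setT F -> (forall x, 0 <= F x) ->
    (\int[mu]_x F x) * (\int[mu]_x F x) <= C%:E * \int[nu]_x (F x * F x).

(** One application of the inequality per coordinate: with G the inner integral
    over the remaining coordinates, the case of one coordinate bounds
    (int G dmu)^2 by C int G^2 dnu, and the induction hypothesis bounds G^2. *)
Lemma l2_dominated_power {d} {T : measurableType d} (C : R)
    (mu nu : {sigma_finite_measure set T -> \bar R}) n :
  (0 <= C)%R -> l2_dominated C mu nu ->
  l2_dominated (C ^+ n) (power_measure mu n) (power_measure nu n).
Proof.
move=> C0 dom; elim: n => [|n IH] F mF F0.
  rewrite !integral_power_measure0 ?expr0 ?mul1e//.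
  by apply: emeasurable_funM.
have F20 t : 0 <= F t * F t by apply: mule_ge0.
have mF2 : measurable_fun [set: n.+1.-tuple T] (fun t => F t * F t).
  by apply: emeasurable_funM.
rewrite !integral_power_measureS//.
set Phi := fun a => \int[power_measure mu n]_t F (cons_pair (a, t)).
have mPhi : measurable_fun setT Phi by exact: measurable_integral_cons.
have Phi0 a : 0 <= Phi a by apply: integral_ge0.
have mG := measurable_integral_cons nu _ _ mF2 F20.
have G0 a : 0 <= \int[power_measure nu n]_t
    (F (cons_pair (a, t)) * F (cons_pair (a, t))).
  by apply: integral_ge0 => *; exact: F20.
apply: (le_trans (dom _ mPhi Phi0)).
rewrite exprS EFinM -muleA lee_wpmul2l ?lee_fin//.
rewrite -ge0_integralZl//; last by rewrite lee_fin exprn_ge0.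
apply: ge0_le_integral => //.
- by move=> a _; exact: mule_ge0.
- exact: emeasurable_funM.
- exact: measurable_funeM.
- move=> a _; apply: IH => //; exact: measurable_fun_cons_pair.
Qed.

End l2_domination.

(** Le Cam's two-point argument: S1 has mass at most eta under mu0, since mu0
    gives 1 - eta to the disjoint set S0, so mu1 gives it at most sqrt(C eta). *)
Lemma l2_dominated_two_point {R : realType} {d} {T : measurableType d}
    (mu0 mu1 : {measure set T -> \bar R}) (C eta : R) (S0 S1 : set T) :
  mu0 setT = 1%E -> 0 <= C -> eta <= 1 -> l2_dominated C mu1 mu0 ->
  measurable S0 -> measurable S1 -> S0 `&` S1 = set0 ->
  ((1 - eta)%:E <= mu0 S0)%E -> ((1 - eta)%:E <= mu1 S1)%E ->
  (1 - eta) ^+ 2 <= C * eta.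
Proof.
move=> mu01 C0 eta1 dom mS0 mS1 S01 h0 h1.
have mI : measurable_fun setT (fun x => (\1_S1 x : R)%:E).
  by apply/measurable_EFinP.
have I0 x : (0 <= (\1_S1 x : R)%:E)%E by rewrite lee_fin.
have := dom _ mI I0; rewrite integral_indic// setIT.
rewrite (eq_integral (fun x => (\1_S1 x : R)%:E)); last first.
  by move=> x _; rewrite -EFinM indicE; case: (_ \in _); rewrite ?mulr1 ?mulr0.
rewrite integral_indic// setIT => {}dom.
have add : (mu0 S0 + mu0 S1 <= 1)%E.
  by rewrite -measureU// -mu01 le_measure// inE//; exact: measurableU.
have mfin : mu0 S1 \is a fin_num.
  rewrite ge0_fin_numE// (le_lt_trans _ (ltry 1))// (le_trans _ add)//.
  by rewrite leeDr.
have h2 : (mu0 S1 <= eta%:E)%E.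
  rewrite -(fineK mfin) in add *.
  have := le_trans (leeD2r _ h0) add; rewrite -EFinD !lee_fin; lra.
have h3 : ((1 - eta)%:E * (1 - eta)%:E <= mu1 S1 * mu1 S1)%E.
  by apply: lee_pmul; rewrite ?lee_fin ?subr_ge0.
have := le_trans h3 (le_trans dom (lee_wpmul2l _ h2)).
by rewrite -!EFinM !lee_fin => /(_ C0); rewrite expr2.
Qed.

Lemma measurable_fun_inv_gt0 {d} {T : measurableType d} {R : realType}
    (f : T -> R) : measurable_fun setT f -> (forall x, 0 < f x) ->
  measurable_fun setT (fun x => (f x)^-1).
Proof.
move=> mf f0; rewrite (_ : (fun x => _) = (@powR R)^~ (-1) \o f).
  by apply: measurableT_comp => //; exact: measurable_powR.
by apply/funext => x /=; rewrite powR_inv1// ltW.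
Qed.

Section weighted.
Context {d} {T : measurableType d} {R : realType}.
Variable mu : {measure set T -> \bar R}.
Local Open Scope ereal_scope.

Lemma weighted_amgm (x : \bar R) (q r k : R) :
  0 <= x -> (0 <= q)%R -> (0 < r)%R -> (0 < k)%R ->
  x * q%:E <= (k / 2)%:E * (x * x * r%:E) + ((2 * k)^-1 * (q ^+ 2 / r))%:E.
Proof.
case: x => [x|_|]//; last first.
  move=> q0 r0 k0; rewrite mulyy (@gt0_mulye _ r%:E) ?lte_fin//.
  rewrite (@gt0_muley _ (k / 2)%:E) ?lte_fin ?divr_gt0//.
  by rewrite leey.
move=> x0 q0 r0 k0; rewrite -!EFinM -EFinD lee_fin -subr_ge0.
rewrite (_ : _ - _ = (k * r * x - q) ^+ 2 / (2 * k * r))%R; last first.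
  by field; rewrite !gt_eqF.
by rewrite divr_ge0 ?sqr_ge0// !mulr_ge0// ltW.
Qed.

(** The choice k = C / x turns the bound into x <= C I / (2 x) + x / 2, which is
    the claim.  It avoids square roots, and I = 0 needs no separate treatment. *)
Lemma sqr_le_of_parametric_amgm (x I C : \bar R) :
  0 <= x -> 0 <= I -> 0 < C -> C < +oo ->
  (forall k : R, (0 < k)%R -> x <= (k / 2)%:E * I + ((2 * k)^-1)%:E * C) ->
  x * x <= C * I.
Proof.
case: C => [C|//|//] x0 I0; rewrite lte_fin => C0 _ H.
case: I I0 H => [I|_ _|//]; last by rewrite gt0_muley ?lte_fin// leey.
rewrite lee_fin => I0 H.
case: x x0 H => [x|_ /(_ 1%R ltr01)|//]; last by rewrite -!EFinM -EFinD leye_eq.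
rewrite lee_fin -!EFinM => x0 H; rewrite lee_fin.
have {}H (k : R) : (0 < k -> 2 * k * x <= k ^+ 2 * I + C)%R.
  move=> k0; have := H _ k0; rewrite -!EFinM -EFinD lee_fin.
  rewrite -(ler_pM2l (_ : 0 < 2 * k)%R) ?mulr_gt0// => /le_trans; apply.
  by rewrite le_eqVlt; apply/orP; left; apply/eqP; field; rewrite gt_eqF.
have [->|xn0] := eqVneq x 0%R; first by rewrite mul0r mulr_ge0// ltW.
have xp : (0 < x)%R by rewrite lt_neqAle eq_sym xn0.
have := H (C / x)%R; rewrite divr_gt0// => /(_ isT).
rewrite (_ : 2 * (C / x) * x = 2 * C)%R; last by field.
rewrite (_ : (C / x) ^+ 2 * I + C = C * (C * I / (x * x)) + C)%R; last by field.
move=> H1; have : (C * 1 <= C * (C * I / (x * x)))%R by lra.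
by rewrite ler_pM2l// ler_pdivlMr ?mulr_gt0// mul1r.
Qed.

(** Cauchy-Schwarz for the product of F sqrt(r) and q / sqrt(r).  As F may take
    the value +oo, it is obtained by integrating the pointwise inequality of
    arithmetic and geometric means with a free parameter k and optimizing over k
    after the integration. *)
Lemma weighted_cauchy_schwarz (F : T -> \bar R) (q r : T -> R) (C : \bar R) :
  measurable_fun setT F -> measurable_fun setT q -> measurable_fun setT r ->
  (forall x, 0 <= F x) -> (forall x, 0 <= q x)%R -> (forall x, 0 < r x)%R ->
  \int[mu]_x (q x ^+ 2 / r x)%:E <= C -> 0 < C -> C < +oo ->
  (\int[mu]_x (F x * (q x)%:E)) * (\int[mu]_x (F x * (q x)%:E)) <=
    C * \int[mu]_x (F x * F x * (r x)%:E).
Proof.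
move=> mF mq mr F0 q0 r0 qrC C0 Cy.
have mqr : measurable_fun setT (fun x => (q x ^+ 2 / r x)%:E).
  apply/measurable_EFinP; apply: measurable_funM; first exact: measurable_funX.
  exact: measurable_fun_inv_gt0.
have mFF : measurable_fun setT (fun x => F x * F x * (r x)%:E).
  by apply: emeasurable_funM; [exact: emeasurable_funM|exact/measurable_EFinP].
have FF0 x : 0 <= F x * F x * (r x)%:E by rewrite !mule_ge0// lee_fin ltW.
have qr0 x : (0 <= q x ^+ 2 / r x)%R by rewrite divr_ge0 ?sqr_ge0// ltW.
apply: sqr_le_of_parametric_amgm => //.
- by apply: integral_ge0 => x _; rewrite mule_ge0 ?lee_fin.
- exact: integral_ge0.
move=> k k0.
apply: (@le_trans _ _ (\int[mu]_x ((k / 2)%:E * (F x * F x * (r x)%:E)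
    + ((2 * k)^-1)%:E * (q x ^+ 2 / r x)%:E))).
  apply: ge0_le_integral => //.
  - by move=> x _; rewrite mule_ge0 ?lee_fin.
  - by apply: emeasurable_funM => //; exact/measurable_EFinP.
  - by apply: emeasurable_funD; exact: measurable_funeM.
  - by move=> x _; rewrite -EFinM; exact: weighted_amgm.
rewrite ge0_integralD//=; first last.
- exact: measurable_funeM.
- by move=> x _; rewrite mule_ge0 ?lee_fin// invr_ge0 mulr_ge0// ltW.
- exact: measurable_funeM.
- by move=> x _; rewrite mule_ge0 ?lee_fin// divr_ge0// ltW.
rewrite !ge0_integralZl//; first last.
- by rewrite lee_fin divr_ge0// ltW.
- by rewrite lee_fin invr_ge0 mulr_ge0// ltW.
- by move=> x _; rewrite lee_fin.
apply: leeD2l; apply: lee_wpmul2l => //.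
by rewrite lee_fin invr_ge0 mulr_ge0// ltW.
Qed.

End weighted.

(** * Probability measures given by a density *)

Section density.
Context {d} {T : measurableType d} {R : realType}.
Variables (mu : {measure set T -> \bar R}) (f : T -> R).
Hypotheses (mf : measurable_fun setT f) (f0 : forall x, 0 <= f x).
Hypothesis f1 : (\int[mu]_x (f x)%:E = 1)%E.
Local Open Scope ereal_scope.

Definition density_measure (B : set T) := \int[mu]_(x in B) (f x)%:E.

Let density0 : density_measure set0 = 0.
Proof. exact: integral_set0. Qed.

Let density_ge0 B : 0 <= density_measure B.
Proof. by apply: integral_ge0 => x _; rewrite lee_fin. Qed.

Let density_sigma_additive : semi_sigma_additive density_measure.
Proof.
move=> F mF tF mUF; rewrite /density_measure; apply: cvg_toP.
  apply: ereal_nondecreasing_is_cvgn => m n mn.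
  by apply: lee_sum_nneg_natr => // k _ _; exact: density_ge0.
rewrite ge0_integral_bigcup//=.
- exact/measurable_funTS/measurable_EFinP.
- by move=> x _; rewrite lee_fin.
Qed.

HB.instance Definition _ := isMeasure.Build _ _ _ density_measure
  density0 density_ge0 density_sigma_additive.

HB.instance Definition _ :=
  Measure_isProbability.Build _ _ R density_measure f1.

Lemma exists_probability_of_density : exists Q : probability T R,
  forall B, Q B = \int[mu]_(x in B) (f x)%:E.
Proof. by exists density_measure. Qed.

End density.

Section integral_density.
Context {d} {T : measurableType d} {R : realType}.
Variables (mu nu : {measure set T -> \bar R}) (f : T -> R).
Hypotheses (mf : measurable_fun setT f) (f0 : forall x, 0 <= f x).
Local Open Scope ereal_scope.
Hypothesis nuE : forall B, measurable B -> nu B = \int[mu]_(x in B) (f x)%:E.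

Import HBNNSimple.

(** Both sides are limits over the same increasing simple functions, and agree
    on indicators by hypothesis. *)
Lemma ge0_integral_density (F : T -> \bar R) :
  measurable_fun setT F -> (forall x, 0 <= F x) ->
  \int[nu]_x F x = \int[mu]_x (F x * (f x)%:E).
Proof.
move=> mF F0; pose h := nnsfun_approx measurableT mF.
have hF x : EFin \o h ^~ x @ \oo --> F x by exact: cvg_nnsfun_approx.
have mfE : measurable_fun setT (EFin \o f) by exact/measurable_EFinP.
transitivity (limn (fun n => \int[nu]_x (h n x)%:E)).
  rewrite -monotone_convergence//.
  - by apply: eq_integral => x _; apply/esym/cvg_lim; last exact: hF.
  - by move=> n; exact/measurable_EFinP.
  - by move=> n x _; rewrite lee_fin.
  - by move=> x _ a b ab; rewrite lee_fin; exact/lefP/nd_nnsfun_approx.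
transitivity (limn (fun n => \int[mu]_x ((h n x)%:E * (f x)%:E))); last first.
  rewrite -monotone_convergence//.
  - apply: eq_integral => x _; apply/cvg_lim => //.
    by apply: cvgeZr => //; exact: hF.
  - by move=> n; apply: emeasurable_funM => //; exact/measurable_EFinP.
  - by move=> n x _; rewrite mule_ge0// lee_fin.
  - move=> x _ a b ab; rewrite lee_wpmul2r// lee_fin//.
    exact/lefP/nd_nnsfun_approx.
congr (limn _); apply/funext => n.
have mh (y : R) : measurable (h n @^-1` [set y]) by [].
under eq_integral do rewrite fimfunE -fsumEFin//.
rewrite ge0_integral_fsum//; last 2 first.
- by move=> y; exact/measurable_EFinP/measurable_funM.
- by move=> y x _; exact: nnfun_muleindic_ge0.
transitivity (\int[mu]_x (\sum_(y \in range (h n))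
    (y * \1_(h n @^-1` [set y]) x)%:E * (f x)%:E)); last first.
  apply: eq_integral => x _.
  rewrite -ge0_mule_fsuml => [|y]; last exact: nnfun_muleindic_ge0.
  by rewrite fsumEFin// -(fimfunE _ x).
rewrite [RHS]ge0_integral_fsum//; last 2 first.
- move=> y; apply: emeasurable_funM => //.
  exact/measurable_EFinP/measurable_funM.
- by move=> y x _; rewrite mule_ge0 ?lee_fin//; exact: nnfun_muleindic_ge0.
apply: eq_fsbigr => y /[!inE] -[t _ <-].
under eq_integral do rewrite EFinM.
rewrite integralZl_indic_nnsfun// integral_indic// setIT nuE//.
under [RHS]eq_integral do rewrite EFinM -muleA.
rewrite ge0_integralZl//; last 3 first.
- by apply: emeasurable_funM => //; exact/measurable_EFinP.
- by move=> x _; rewrite mule_ge0 ?lee_fin.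
- by rewrite lee_fin.
congr (_ * _); rewrite integral_mkcond; apply: eq_integral => x _.
by rewrite epatch_indic muleC.
Qed.

End integral_density.

(** * Coordinatewise change of variables *)

Section power_transport.
Context {d} {T : measurableType d} {R : realType}.
Local Open Scope ereal_scope.

Lemma measurable_map_tuple n (phi : 'I_n -> T -> T) :
  (forall i, measurable_fun setT (phi i)) ->
  measurable_fun [set: n.-tuple T]
    (fun z => [tuple phi i (tnth z i) | i < n] : n.-tuple T).
Proof.
move=> mphi; apply/measurable_fun_tnthP => i.
rewrite (_ : _ \o _ = phi i \o (fun z : n.-tuple T => tnth z i)).
  by apply: measurableT_comp => //; exact: measurable_tnth.
by apply/funext => z /=; rewrite tnth_mktuple.
Qed.

Lemma measurable_prod_tnth n (f : 'I_n -> T -> R) :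
  (forall i, measurable_fun setT (f i)) ->
  measurable_fun [set: n.-tuple T] (fun z => \prod_(i < n) f i (tnth z i))%R.
Proof.
move=> mf; apply: measurable_prod => i _.
by apply: (measurableT_comp (mf i)); exact: measurable_tnth.
Qed.

(** The hypothesis says that nu is the image under each phi_i of the measure
    with density f_i with respect to mu.  There are two uses: with phi_i the
    identity, to pass from Lebesgue measure to a product of probability
    densities, and with mu = nu and phi_j a dilation, to rescale one coordinate. *)
Lemma integral_power_transport (mu nu : {sigma_finite_measure set T -> \bar R})
    n (phi : 'I_n -> T -> T) (f : 'I_n -> T -> R) :
  (forall i, measurable_fun setT (phi i)) ->
  (forall i, measurable_fun setT (f i)) -> (forall i x, 0 <= f i x)%R ->
  (forall i (F : T -> \bar R), measurable_fun setT F -> (forall x, 0 <= F x) ->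
     \int[nu]_x F x = \int[mu]_x (F (phi i x) * (f i x)%:E)) ->
  forall F : n.-tuple T -> \bar R,
    measurable_fun [set: n.-tuple T] F -> (forall z, 0 <= F z) ->
  \int[power_measure nu n]_z F z =
  \int[power_measure mu n]_z
    (F [tuple phi i (tnth z i) | i < n] * (\prod_(i < n) f i (tnth z i))%:E).
Proof.
elim: n phi f => [|n IH] phi f mphi mf f0 H F mF F0.
  have mF' : measurable_fun [set: 0.-tuple T]
      (fun z => F [tuple phi i (tnth z i) | i < 0] *
                (\prod_(i < 0) f i (tnth z i))%:E).
    apply: emeasurable_funM; last first.
      by apply/measurable_EFinP; exact: measurable_prod_tnth.
    by apply: (measurableT_comp mF); exact: measurable_map_tuple.
  rewrite !integral_power_measure0// big_ord0 mule1; congr F.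
  by apply: eq_from_tnth => -[].
have mF' : measurable_fun [set: n.+1.-tuple T]
    (fun z => F [tuple phi i (tnth z i) | i < n.+1] *
              (\prod_(i < n.+1) f i (tnth z i))%:E).
  apply: emeasurable_funM; last first.
    by apply/measurable_EFinP; exact: measurable_prod_tnth.
  by apply: (measurableT_comp mF); exact: measurable_map_tuple.
rewrite !integral_power_measureS//; last first.
  by move=> z; rewrite mule_ge0// lee_fin prodr_ge0.
rewrite (H ord0)//; first last.
- by move=> a; apply: integral_ge0 => z _; exact: F0.
- exact: measurable_integral_cons.
apply: eq_integral => a _.
have mFa b : measurable_fun [set: n.-tuple T] (fun t => F (cons_pair (b, t))).
  exact: measurable_fun_cons_pair.
rewrite (IH (fun i => phi (lift ord0 i)) (fun i => f (lift ord0 i)))//;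
  last first.
  by move=> i; exact: H.
have mFp b : measurable_fun [set: n.-tuple T] (fun z =>
   F (cons_pair (b, [tuple phi (lift ord0 i) (tnth z i) | i < n])) *
   (\prod_(i < n) f (lift ord0 i) (tnth z i))%:E).
  apply: emeasurable_funM; last first.
    apply/measurable_EFinP.
    exact: (@measurable_prod_tnth _ (fun i => f (lift ord0 i))).
  apply: (measurableT_comp (mFa b)).
  exact: (@measurable_map_tuple _ (fun i => phi (lift ord0 i))).
rewrite -ge0_integralZr//; last 2 first.
- by move=> z _; rewrite mule_ge0// lee_fin prodr_ge0.
- by rewrite lee_fin.
apply: eq_integral => z _; rewrite -muleA; congr (F _ * _).
  apply: eq_from_tnth => i; rewrite tnth_mktuple.
  case: (unliftP ord0 i) => [j ->|->] //.
  by rewrite /cons_pair !tnthS tnth_mktuple.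
rewrite -EFinM big_ord_recl mulrC; congr (_ * _)%:E.
by apply: eq_bigr => i _; rewrite tnthS.
Qed.

Lemma power_measure_setT (mu : {sigma_finite_measure set T -> \bar R}) n :
  mu setT = 1 -> power_measure mu n setT = 1.
Proof.
move=> mu1.
have := @power_measure_box _ _ _ mu n _ (fun _ : 'I_n => measurableT).
rewrite big1// => <-; congr (power_measure mu n _).
by apply/seteqP; split.
Qed.

End power_transport.

(** * The one-dimensional Pareto law *)

Lemma cvgr_lny {R : realType} : @ln R x @[x --> +oo] --> +oo.
Proof.
apply/cvgryPge => M; near=> x.
have Mx : expR M <= x by near: x; apply: nbhs_pinfty_ge; rewrite num_real.
by rewrite -(expRK M) ler_ln ?posrE ?expR_gt0// (lt_le_trans _ Mx)// expR_gt0.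
Unshelve. all: by end_near. Qed.

Lemma ge0_integral_lebesgue_scale {R : realType} (t : R)
    (F : measurableTypeR R -> \bar R) : 0 < t ->
  measurable_fun setT F -> (forall x, (0 <= F x)%E) ->
  (\int[lebesgue_measure]_x F x =
   \int[lebesgue_measure]_x (F (t * x)%R * t%:E))%E.
Proof.
move=> t0 mF F0.
pose phi : measurableTypeR R -> measurableTypeR R := fun x => t * x.
have mphi : measurable_fun setT phi by exact: mulrl_measurable.
unshelve epose (lphi := (pushforward lebesgue_measure phi :
  {measure set (measurableTypeR R) -> \bar R})); first exact: mphi.
pose nu := mscale (NngNum (ltW t0)) lphi.
transitivity (\int[nu]_x F x)%E.
  apply: eq_measure_integral => A mA _; apply: lebesgue_measure_unique => //.
  move=> _ [[x y] _ <-].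
  change (lebesgue_measure `]x, y]%classic =
    (t%:E * lebesgue_measure (phi @^-1` `]x, y]%classic))%E).
  rewrite (_ : phi @^-1` _ = `]x / t, y / t]%classic); last first.
    apply/seteqP; split => z /=; rewrite !in_itv/= /phi => /andP[];
      by rewrite ltr_pdivrMr// ler_pdivlMr// ![z * t]mulrC => -> ->.
  rewrite !lebesgue_measure_itv/= !lte_fin ltr_pM2r ?invr_gt0//.
  case: ifPn => _; last by rewrite mule0.
  rewrite -!EFinB -EFinM; congr EFin; field; exact: lt0r_neq0.
rewrite ge0_integral_mscale//= ge0_integral_pushforward//=.
rewrite preimage_setT -ge0_integralZl//.
- by apply: eq_integral => x _; rewrite muleC.
- exact: measurableT_comp.
- by rewrite lee_fin ltW.
Qed.

Section pareto1.
Context {R : realType}.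
Variable a : R.
Hypothesis a0 : 0 < a.
Notation mu := (@lebesgue_measure R).

Let f (x : R) : R := a * (1 + x) `^ (- (a + 1)).
Let F (x : R) : R := - (1 + x) `^ (- a).

Let shift_gt0 (x : R) : -1 < x -> 0 < 1 + x.
Proof. by move=> ?; rewrite -ltrBlDl sub0r. Qed.

Let is_derive_F (x : R) : -1 < x -> is_derive x 1 F (f x).
Proof.
move=> x1; rewrite /F /f.
have h : is_derive (1 + x) (1:R) (@powR R ^~ (- a))
    (- a * (1 + x) `^ (- a - 1)).
  exact/is_derive1_powR/shift_gt0.
have g : is_derive x 1 (cst (1:R) + id) (0 + 1) by exact: is_deriveD.
have := @is_derive1_comp _ (@powR R ^~ (- a)) (cst (1:R) + id) x _ _ h g.
move=> /is_deriveN; rewrite add0r mulr1 mulNr opprK -opprD.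
exact.
Qed.

Let continuous_f (x : R) : -1 < x -> {for x, continuous f}.
Proof.
move=> x1; apply: continuousM; first exact: cst_continuous.
apply: (@continuous_comp _ _ _ (fun x : R => 1 + x) (@powR R ^~ (- (a + 1)))).
  apply: continuousD => //; exact: cst_continuous.
apply/differentiable_continuous/derivable1_diffP.
by apply: derivable_powR; rewrite in_itv/= andbT shift_gt0.
Qed.

Lemma integral_pareto_tail (r : R) : 0 <= r ->
  (\int[mu]_(x in `[r, +oo[) (f x)%:E = ((1 + r) `^ (- a))%:E)%E.
Proof.
move=> r0.
have rx (x : R) : r <= x -> -1 < x.
  by move=> rx; rewrite (lt_le_trans _ rx)// (lt_le_trans _ r0)// ltrN10.
rewrite (@ge0_continuous_FTC2y _ f F r 0).
- by rewrite add0e -EFinN opprK.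
- by move=> x _; rewrite mulr_ge0 ?powR_ge0// ltW.
- apply: continuous_in_subspaceT => x; rewrite inE/= in_itv/= andbT => rx'.
  exact/continuous_f/rx.
- rewrite -oppr0; apply: cvgN.
  have : (expR (- (a * ln (1 + x)))) @[x --> +oo] --> (0:R).
    apply: (@cvg_comp _ _ _ (fun x => a * ln (1 + x)) (fun y => expR (- y)) _
      (pinfty_nbhs R)); last exact: cvgr_expR.
    apply: gt0_cvgMry => //.
    apply: (@cvg_comp _ _ _ (fun x : R => 1 + x) (@ln R) _ (pinfty_nbhs R)).
      exact: cvg_addrl.
    exact: cvgr_lny.
  apply: cvg_trans; apply: near_eq_cvg; near=> x.
  have x0 : 0 < 1 + x.
    by apply: shift_gt0; near: x; apply: nbhs_pinfty_gt; rewrite num_real.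
  by rewrite /powR gt_eqF// mulNr.
- by move=> x /ltW/rx/is_derive_F[].
- apply: cvg_at_right_filter; apply/differentiable_continuous/derivable1_diffP.
  by have [] := is_derive_F _ (rx _ (lexx r)).
- move=> x; rewrite in_itv/= andbT => /ltW/rx x1.
  by rewrite derive1E; have [_ ->] := is_derive_F _ x1.
Unshelve. all: by end_near. Qed.

Definition pareto_pdf (x : R) : R := if 0 <= x then f x else 0.

Lemma pareto_pdf_ge0 x : 0 <= pareto_pdf x.
Proof.
by rewrite /pareto_pdf; case: ifP => // _; rewrite mulr_ge0 ?powR_ge0 ?ltW.
Qed.

Let measurable_f : measurable_fun setT f.
Proof.
apply: measurable_funM => //.
apply: (measurableT_comp (measurable_powR _)).
exact: measurable_funD.
Qed.

Lemma measurable_pareto_pdf : measurable_fun setT pareto_pdf.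
Proof.
apply: measurable_fun_if => //.
- exact: measurable_fun_ler.
- exact: measurable_funTS.
Qed.

Lemma integral_pareto_pdf (D : set R) :
  (\int[mu]_(x in D) (pareto_pdf x)%:E =
   \int[mu]_(x in D `&` `[0%R, +oo[%classic) (f x)%:E)%E.
Proof.
rewrite [RHS]integral_mkcondr; apply: eq_integral => x _.
rewrite /pareto_pdf patchE; case: ifPn => [x0|x0].
  by rewrite mem_set//= in_itv/= x0.
by rewrite memNset//= in_itv/= andbT; apply/negP.
Qed.

(** The density, at x, of the Pareto law rescaled by 1 / t with respect to the
    Pareto law itself.  The absolute value extends the formula for x >= 0 to a
    function that is positive on the whole line and tends to 1 uniformly as t
    tends to 1. *)
Definition scale_weight (t x : R) : R :=
  t * ((1 + `|x|) / (1 + t * `|x|)) `^ (a + 1).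

Lemma measurable_scale_weight t : 0 < t -> measurable_fun setT (scale_weight t).
Proof.
move=> t0; apply: measurable_funM => //.
apply: (measurableT_comp (measurable_powR _)).
apply: measurable_funM; first exact: measurable_funD.
apply: measurable_fun_inv_gt0.
  by apply: measurable_funD => //; apply: measurable_funM.
by move=> x; rewrite ltr_pwDl// mulr_ge0// ltW.
Qed.

Lemma pareto_pdf_scale (t x : R) : 0 < t ->
  pareto_pdf (t * x) * t =
  scale_weight t x * pareto_pdf x.
Proof.
move=> t0; rewrite /pareto_pdf /scale_weight pmulr_rge0//.
case: ifPn => [x0|_]; last by rewrite mul0r mulr0.
rewrite ger0_norm// /f !powRN.
have tx0 : 0 < 1 + t * x by rewrite ltr_wpDr// mulr_ge0// ltW.
have h1 : 0 < (1 + x) `^ (a + 1) by rewrite powR_gt0// ltr_wpDr.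
have h2 : 0 < (1 + t * x) `^ (a + 1) by rewrite powR_gt0.
rewrite powRM ?invr_ge0 ?(ltW tx0) ?addr_ge0//.
rewrite -(powR_inv1 (ltW tx0)) powRAC powR_inv1 ?powR_ge0//.
by field; rewrite !gt_eqF.
Qed.

Lemma exists_pareto_law : exists P : probability (measurableTypeR R) R,
  [/\ forall B, P B = (\int[mu]_(x in B) (pareto_pdf x)%:E)%E,
      forall r, 0 <= r -> P [set x | r < x] = ((1 + r) `^ (- a))%:E &
      forall t, 0 < t -> forall F : measurableTypeR R -> \bar R,
        measurable_fun setT F -> (forall x, (0 <= F x)%E) ->
        (\int[P]_x F x =
         \int[P]_x (F (t * x)%R * (scale_weight t x)%:E))%E].
Proof.
have mu1 : (\int[mu]_x (pareto_pdf x)%:E = 1)%E.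
  by rewrite integral_pareto_pdf setTI integral_pareto_tail// addr0 powR1.
have [P PE] := exists_probability_of_density mu pareto_pdf
    measurable_pareto_pdf pareto_pdf_ge0 mu1.
exists P; split => // [r r0|t t0 G mG G0].
  rewrite PE integral_pareto_pdf (_ : _ `&` _ = `]r, +oo[%classic).
    rewrite integral_itv_obnd_cbnd ?integral_pareto_tail//.
    apply/measurable_EFinP/measurable_funTS.
    exact: measurable_f.
  apply/seteqP; split => x /=; rewrite !in_itv/= !andbT; first by case.
  by move=> rx; split => //; rewrite (le_trans r0)// ltW.
have mpdf := measurable_pareto_pdf.
have mw := measurable_scale_weight _ t0.
have PE' B : measurable B -> P B = (\int[mu]_(x in B) (pareto_pdf x)%:E)%E.
  by [].
rewrite !(ge0_integral_density mu P pareto_pdf mpdf pareto_pdf_ge0 PE')//;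
  last 2 first.
- apply: emeasurable_funM; last exact/measurable_EFinP.
  by apply: (measurableT_comp mG); exact: mulrl_measurable.
- by move=> x; rewrite mule_ge0// lee_fin mulr_ge0 ?powR_ge0// ltW.
rewrite (ge0_integral_lebesgue_scale t)//; last 2 first.
- by apply: emeasurable_funM => //; exact/measurable_EFinP.
- by move=> x; rewrite mule_ge0// lee_fin pareto_pdf_ge0.
apply: eq_integral => x _.
by rewrite -!muleA -!EFinM pareto_pdf_scale.
Qed.

End pareto1.

(** * Tilting a probability measure inside a region *)

Section tilt.
Local Open Scope ereal_scope.

(** Let q equal r on B and the Q-average c of r over the complement of B there;
    this keeps the total mass, and c is as close to 1 as r is.  Since q and r
    both integrate to 1, int q^2 / r = 1 + int (q - r)^2 / r, and q - r vanishes
    on B and is at most 2 e in absolute value elsewhere. *)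
Lemma exists_tilt {d} {T : measurableType d} {R : realType}
    (Q : {measure set T -> \bar R}) (r : T -> R) (B : set T) (e : R) :
  Q setT = 1 -> measurable B -> measurable_fun setT r ->
  (0 <= e)%R -> (e <= 2^-1)%R -> (forall x, `|r x - 1| <= e)%R ->
  \int[Q]_x (r x)%:E = 1 -> 0 < Q (~` B) ->
  exists q : T -> R, exists c : R,
  [/\ measurable_fun setT q, forall x, (`|q x - 1| <= e)%R,
      forall x, ~ B x -> q x = c, \int[Q]_x (q x)%:E = 1 &
      \int[Q]_x (q x ^+ 2 / r x)%:E <= 1 + (8 * e ^+ 2)%:E * Q (~` B)].
Proof.
move=> Q1 mB mr e_ge0 e_le re r1 QB.
have r_ge x : (2^-1 <= r x)%R.
  by have := re x; rewrite ler_norml => /andP[? ?]; lra.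
have r_gt0 x : (0 < r x)%R by rewrite (lt_le_trans _ (r_ge x))// invr_gt0.
have mC : measurable (~` B) by exact: measurableC.
have QCle1 : Q (~` B) <= 1 by rewrite -Q1 le_measure// inE.
have QCfin : Q (~` B) \is a fin_num.
  by rewrite ge0_fin_numE// (le_lt_trans QCle1)// ltry.
set v := fine (Q (~` B)).
have vE : Q (~` B) = v%:E by rewrite /v fineK.
have v0 : (0 < v)%R by rewrite -lte_fin -vE.
have mrE D : measurable_fun D (fun x => (r x)%:E).
  by apply: measurable_funTS; exact/measurable_EFinP.
have r0E x : 0 <= (r x)%:E by rewrite lee_fin ltW.
have rv : \int[Q]_(x in B) (r x)%:E + \int[Q]_(x in ~` B) (r x)%:E = 1.
  rewrite -r1 -(setUv B) ge0_integral_setU//; exact/disj_setPCl.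
have Ile : \int[Q]_(x in ~` B) (r x)%:E <= ((1 + e) * v)%:E.
  rewrite EFinM -vE -integral_cst//; apply: ge0_le_integral => //.
  move=> x _; rewrite lee_fin; have := re x.
  by rewrite ler_norml => /andP[? ?]; lra.
have Ige : ((1 - e) * v)%:E <= \int[Q]_(x in ~` B) (r x)%:E.
  rewrite EFinM -vE -integral_cst//; apply: ge0_le_integral => //.
    by move=> x _; rewrite lee_fin; lra.
  move=> x _; rewrite lee_fin; have := re x.
  by rewrite ler_norml => /andP[? ?]; lra.
have Ifin : \int[Q]_(x in ~` B) (r x)%:E \is a fin_num.
  rewrite ge0_fin_numE; last exact: integral_ge0.
  by rewrite (le_lt_trans Ile)// ltry.
set I := fine (\int[Q]_(x in ~` B) (r x)%:E).
have IE : \int[Q]_(x in ~` B) (r x)%:E = I%:E by rewrite /I fineK.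
move: Ile Ige; rewrite IE !lee_fin => Ile Ige.
pose c := (I / v)%R.
have ce : (`|c - 1| <= e)%R.
  have h1 : (1 - e <= c)%R by rewrite ler_pdivlMr.
  have h2 : (c <= 1 + e)%R by rewrite ler_pdivrMr.
  by rewrite ler_norml; apply/andP; split; lra.
pose q x := if x \in B then r x else c.
have mq : measurable_fun setT q.
  rewrite (_ : q = fun x => r x * \1_B x + c * \1_(~` B) x)%R; last first.
    apply/funext => x; rewrite /q !indicE in_setC.
    by case: (x \in B); rewrite !(mulr1, mulr0) ?addr0 ?add0r.
  by apply: measurable_funD; apply: measurable_funM => //;
    apply: measurable_indic.
have qe x : (`|q x - 1| <= e)%R by rewrite /q; case: ifP.
have q0 x : (0 <= q x)%R by have := qe x; rewrite ler_norml => /andP[? ?]; lra.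
have q1 : \int[Q]_x (q x)%:E = 1.
  rewrite -rv -(setUv B) ge0_integral_setU//.
  - congr (_ + _).
      by apply: eq_integral => x xB; rewrite /q xB.
    rewrite IE (eq_integral (cst c%:E)).
      by rewrite integral_cst// vE -EFinM divfK// gt_eqF.
    by move=> x; rewrite inE => xB; rewrite /q memNset.
  - exact: measurable_funTS (measurableT_comp _ mq).
  - by move=> x _; rewrite lee_fin.
  - exact/disj_setPCl.
exists q, c; split => //.
  by move=> x xB; rewrite /q memNset.
have mqr : measurable_fun setT (fun x => (q x ^+ 2 / r x)%:E).
  apply/measurable_EFinP; apply: measurable_funM; first exact: measurable_funX.
  exact: measurable_fun_inv_gt0.
have qr0 x : 0 <= (q x ^+ 2 / r x)%:E.
  by rewrite lee_fin divr_ge0 ?sqr_ge0// ltW.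
(* The expansion of int (q - r)^2 / r, with the negative terms moved across so
   that all integrands are nonnegative. *)
rewrite -(@leeD2rE _ 1)//.
rewrite -[X in _ + X <= _]r1 -ge0_integralD//.
pose G x := 2%:E * (q x)%:E + (8 * e ^+ 2)%:E * (\1_(~` B) x)%:E.
have mI : measurable_fun setT (fun x => (\1_(~` B) x : R)%:E).
  by apply/measurable_EFinP.
have mqE : measurable_fun setT (fun x => (q x)%:E) by exact/measurable_EFinP.
apply: (@le_trans _ _ (\int[Q]_x G x)).
  apply: ge0_le_integral => //.
  - by move=> x _; rewrite adde_ge0.
  - by apply: emeasurable_funD => //; exact: mrE.
  - by apply: emeasurable_funD; apply: measurable_funeM.
  - move=> x _; rewrite /G -!EFinM -!EFinD lee_fin.
    rewrite (_ : q x ^+ 2 / r x + r x =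
      2 * q x + (q x - r x) ^+ 2 / r x)%R; last first.
      by field; rewrite gt_eqF.
    rewrite lerD2l /q indicE in_setC; case: (x \in B).
      by rewrite subrr expr0n mul0r mulr0.
    rewrite mulr1 ler_pdivrMr//.
    have h1 : (`|c - r x| <= 2 * e)%R.
      rewrite (_ : c - r x = (c - 1) - (r x - 1))%R; last by ring.
      by rewrite (le_trans (ler_normB _ _))//; have := re x; lra.
    rewrite -real_normK ?num_real//.
    apply: (@le_trans _ _ ((2 * e) ^+ 2)%R).
      by rewrite lerXn2r ?nnegrE ?mulr_ge0.
    have := r_ge x; have := sqr_ge0 e; nra.
rewrite /G ge0_integralD//; first last.
- exact: measurable_funeM.
- by move=> x _; rewrite mule_ge0 ?lee_fin// mulr_ge0 ?sqr_ge0.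
- exact: measurable_funeM.
- by move=> x _; rewrite mule_ge0 ?lee_fin.
rewrite !ge0_integralZl//; first last.
- by move=> x _; rewrite lee_fin.
- by rewrite lee_fin mulr_ge0// sqr_ge0.
rewrite q1 integral_indic// setIT mule1 addeAC.
by rewrite -EFinD lexx.
Qed.

End tilt.

(** * Noise laws close to the product Pareto law *)

Section pareto_noise.
Context {R : realType}.
Variables (alpha : R) (P : probability (measurableTypeR R) R).
Hypothesis alpha_gt0 : 0 < alpha.
Hypothesis PE : forall B : set (measurableTypeR R), measurable B ->
  P B = (\int[lebesgue_measure]_(x in B) (pareto_pdf alpha x)%:E)%E.
Hypothesis P_tail : forall r, 0 <= r ->
  P [set x | r < x] = ((1 + r) `^ (- alpha))%:E.
Hypothesis P_scale : forall t, 0 < t -> forall F : measurableTypeR R -> \bar R,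
  measurable_fun setT F -> (forall x, (0 <= F x)%E) ->
  (\int[P]_x F x = \int[P]_x (F (t * x)%R * (scale_weight alpha t x)%:E))%E.

Let Pi m := power_measure P m.

Lemma pareto_density_gt0 m (z : 'V[R]_m) : orthant z ->
  0 < pareto_density alpha z.
Proof.
move=> z0; rewrite /pareto_density mulr_gt0 ?exprn_gt0//.
by apply: prodr_gt0 => i _; rewrite powR_gt0// ltr_wpDr.
Qed.

Lemma prod_pareto_pdf m (z : 'V[R]_m) :
  \prod_(i < m) pareto_pdf alpha (tnth z i) =
  (pareto_density alpha \_ (@orthant R m)) z.
Proof.
rewrite patchE; case: ifPn => [/set_mem z0|z0].
  rewrite (eq_bigr (fun i => alpha * (1 + tnth z i) `^ (- (alpha + 1)))).
    by rewrite big_split prodr_const card_ord.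
  by move=> i _; rewrite /pareto_pdf z0.
have [i zi] : exists i, tnth z i < 0.
  apply/existsP; apply: contraNT z0; rewrite negb_exists => /forallP z0.
  by apply/mem_set => i; rewrite leNgt.
by rewrite (bigD1 i)//= /pareto_pdf leNgt zi/= mul0r.
Qed.

Lemma integral_pareto_noise m (F : 'V[R]_m -> \bar R) :
  measurable_fun [set: 'V[R]_m] F -> (forall z, (0 <= F z)%E) ->
  (\int[Pi m]_z F z = \int[lebesgue_tuple R m]_(z in @orthant R m)
     (F z * (pareto_density alpha z)%:E))%E.
Proof.
move=> mF F0.
rewrite (integral_power_transport lebesgue_measure P m (fun _ => id)
  (fun _ => pareto_pdf alpha))//.
- rewrite [RHS]integral_mkcond; apply: eq_integral => z _.
  rewrite prod_pareto_pdf !patchE; case: ifPn => _; last by rewrite mule0.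
  by congr (F _ * _)%E; apply: eq_from_tnth => i; rewrite tnth_mktuple.
- by move=> i; exact: measurable_pareto_pdf.
- by move=> i x; exact: pareto_pdf_ge0.
- move=> i G mG G0; apply: ge0_integral_density => //.
    exact: measurable_pareto_pdf.
  by move=> x; exact: pareto_pdf_ge0.
Qed.

Lemma measurable_pareto_shape m :
  measurable_fun [set: 'V[R]_m] (fun z : 'V[R]_m => pareto_shape alpha z).
Proof.
apply: (@measurable_prod_tnth _ (measurableTypeR R) R m
  (fun _ x => (1 + x) `^ (- (alpha + 1)))).
move=> i; apply: (measurableT_comp (measurable_powR _)).
exact: measurable_funD.
Qed.

(** Membership in the noise class, expressed by the density q relative to the
    product Pareto law: the relative error becomes |q - 1|, and proportionality to
    the Pareto shape becomes constancy of q far from the origin. *)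
Lemma exists_noise_law m s xi zeta (k : nat) (q : 'V[R]_m -> R) (c : R) :
  measurable_fun [set: 'V[R]_m] q -> (forall z, 0 <= q z) ->
  (forall z, `|q z - 1| <= xi * k%:R `^ (- s)) ->
  (forall z, orthant z -> zeta * k%:R `^ ((1 - 2 * s) / alpha) < l1norm z ->
    q z = c) ->
  (\int[Pi m]_z (q z)%:E = 1)%E ->
  exists2 Q : probability 'V[R]_m R, noise_class alpha s xi zeta k Q &
    forall F : 'V[R]_m -> \bar R, measurable_fun [set: 'V[R]_m] F ->
      (forall z, (0 <= F z)%E) ->
      (\int[Q]_z F z = \int[Pi m]_z (F z * (q z)%:E))%E.
Proof.
move=> mq q0 qxi qc q1.
have [Q QE] := exists_probability_of_density (Pi m) q mq q0 q1.
exists Q; last first.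
  by move=> F mF F0; apply: ge0_integral_density => // B _; exact: QE.
exists (fun z => q z * pareto_density alpha z); split.
- apply: measurable_funTS; apply: measurable_funM => //.
  by apply: measurable_funM => //; exact: measurable_pareto_shape.
- move=> B mB; rewrite QE integral_mkcond integral_pareto_noise//; last 2 first.
  + apply/(measurable_restrictT _ mB); apply: measurable_funTS.
    exact/measurable_EFinP.
  + by move=> z; rewrite patchE; case: ifP => // _; rewrite lee_fin.
  rewrite setIC [RHS]integral_mkcondr; apply: eq_integral => z _.
  by rewrite !patchE; case: ifP => _; rewrite ?mul0e.
- move=> z z0; rewrite -{2}(mul1r (pareto_density alpha z)) -mulrBl mulfK//.
  by rewrite gt_eqF// pareto_density_gt0.
- exists (c * alpha ^+ m) => z z0 zz; rewrite (qc z z0 zz).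
  by rewrite /pareto_density mulrA.
Qed.

Definition scale_coord {m} (j : 'I_m) (t : R) (z : 'V[R]_m) : 'V[R]_m :=
  [tuple if i == j then t * tnth z i else tnth z i | i < m].

Lemma measurable_scale_coord m (j : 'I_m) t :
  measurable_fun [set: 'V[R]_m] (scale_coord j t).
Proof.
apply: (@measurable_map_tuple _ (measurableTypeR R) m
  (fun i x => if i == j then t * x else x)) => i.
by case: (i == j) => //; exact: mulrl_measurable.
Qed.

Lemma integral_scale_coord m (j : 'I_m) (t : R) (F : 'V[R]_m -> \bar R) :
  0 < t -> measurable_fun [set: 'V[R]_m] F -> (forall z, (0 <= F z)%E) ->
  (\int[Pi m]_z F z =
   \int[Pi m]_z (F (scale_coord j t z) *
                 (scale_weight alpha t (tnth z j))%:E))%E.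
Proof.
move=> t0 mF F0.
rewrite (integral_power_transport P P m
  (fun i x => if i == j then t * x else x)
  (fun i x => if i == j then scale_weight alpha t x else 1))//.
- apply: eq_integral => z _; congr (_ * _%:E)%E.
  rewrite (bigD1 j)//= eqxx big1 ?mulr1// => i ij.
  by rewrite (negbTE ij).
- by move=> i; case: (i == j) => //; exact: mulrl_measurable.
- by move=> i; case: (i == j) => //; exact: measurable_scale_weight.
- move=> i x; case: (i == j) => //.
  by rewrite mulr_ge0 ?powR_ge0 ?ltW.
- move=> i G mG G0; case: (i == j); first exact: P_scale.
  by apply: eq_integral => x _; rewrite mule1.
Qed.

Lemma expR_sub1_le (b : R) : 0 <= b -> b <= 2^-1 -> expR b - 1 <= 2 * b.
Proof.
move=> b0 b2; have h := expR_ge1Dx (- b); rewrite expRN in h.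
have e0 := expR_gt0 b.
have : (1 - b) * expR b <= 1.
  by rewrite -ler_pdivlMr// mul1r.
nra.
Qed.

(** For t = exp(th), the ratio (1 + y) / (1 + t y) lies between 1 and 1 / t, so
    the weight lies between t and t^(-alpha). *)
Lemma scale_weight_close (th x : R) : (alpha + 1) * `|th| <= 2^-1 ->
  `|scale_weight alpha (expR th) x - 1| <= 2 * ((alpha + 1) * `|th|).
Proof.
have al0 := alpha_gt0; move=> th2; set b := (alpha + 1) * `|th| in th2 *.
have b0 : 0 <= b by rewrite mulr_ge0// addr_ge0// ltW.
suff /andP[wl wr] : expR (- b) <= scale_weight alpha (expR th) x <= expR b.
  have h1 := expR_sub1_le b b0 th2; have h2 := expR_ge1Dx (- b).
  by rewrite ler_norml; apply/andP; split; lra.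
rewrite /scale_weight; set y := `|x|.
have y0 : 0 <= y by exact: normr_ge0.
have t0 := expR_gt0 th.
have ty0 : 0 < 1 + expR th * y by rewrite ltr_pwDl// mulr_ge0// ltW.
set g := (1 + y) / _.
have a1 : 0 <= alpha + 1 by rewrite addr_ge0// ltW.
have powe u : (expR u) `^ (alpha + 1) = expR (u * (alpha + 1)) by rewrite expRM.
have mono u v : 0 <= u -> u <= v -> u `^ (alpha + 1) <= v `^ (alpha + 1).
  by move=> u0 uv; apply: ge0_ler_powR; rewrite ?nnegrE// (le_trans u0).
have ga0 : 0 <= g by rewrite divr_ge0 ?(ltW ty0) ?addr_ge0.
have [th0|th0] := leP 0 th.
  have t1 : 1 <= expR th by rewrite -expR0 ler_expR.
  have g1 : g <= 1 by rewrite ler_pdivrMr// mul1r lerD2l ler_peMl.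
  have gt : expR (- th) <= g.
    rewrite ler_pdivlMr// expRN mulrDr mulr1 mulKf ?gt_eqF//.
    by rewrite lerD2r invf_le1.
  have bE : b = (alpha + 1) * th by rewrite /b ger0_norm.
  apply/andP; split.
    apply: (@le_trans _ _ (expR th * (expR (- th)) `^ (alpha + 1))).
      rewrite powe -expRD ler_expR bE; nra.
    by rewrite ler_pM2l// mono ?expR_ge0.
  apply: (@le_trans _ _ (expR th * 1 `^ (alpha + 1))).
    by rewrite ler_pM2l// mono.
  by rewrite powR1 mulr1 ler_expR bE; nra.
have t1 : expR th <= 1 by rewrite -expR0 ler_expR ltW.
have g1 : 1 <= g by rewrite ler_pdivlMr// mul1r lerD2l ler_piMl.
have gt : g <= expR (- th).
  rewrite ler_pdivrMr// expRN mulrDr mulr1 mulKf ?gt_eqF//.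
  by rewrite lerD2r invf_ge1.
have bE : b = - ((alpha + 1) * th) by rewrite /b ltr0_norm// mulrN.
apply/andP; split.
  apply: (@le_trans _ _ (expR th * 1 `^ (alpha + 1))).
    by rewrite powR1 mulr1 ler_expR bE; nra.
  by rewrite ler_pM2l// mono.
apply: (@le_trans _ _ (expR th * (expR (- th)) `^ (alpha + 1))).
  by rewrite ler_pM2l// mono.
rewrite powe -expRD ler_expR bE; nra.
Qed.

Lemma one_sub_muln_le_expr (x : R) n :
  0 <= x -> x <= 1 -> 1 - n%:R * x <= (1 - x) ^+ n.
Proof.
move=> x0 x1; elim: n => [|n IH]; first by rewrite expr0 mul0r subr0.
rewrite exprS -natr1; have := ler0n R n.
have : (1 - x) * (1 - n%:R * x) <= (1 - x) * (1 - x) ^+ n.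
  by rewrite ler_wpM2l// subr_ge0.
nra.
Qed.

(** The region where the tilt is allowed.  A cube is preferred to an l1 ball
    because product measures give its mass exactly, and the cube of upper
    vertex (rho, ..., rho) meets the orthant inside the ball of radius m rho. *)
Definition cube m (rho : R) : set 'V[R]_m := [set z | forall i, tnth z i <= rho].

Lemma measurable_cube m rho : measurable (cube m rho).
Proof.
rewrite (_ : cube m rho = \bigcap_(i in [set: 'I_m])
    ((fun z : 'V[R]_m => tnth z i) @^-1` [set x | x <= rho])).
  apply: fin_bigcap_measurable => // i _.
  rewrite -[X in measurable X]setTI; apply: measurable_tnth => //.
  rewrite -[X in measurable X]/`]-oo, rho]%classic -set_itvNyc.
  exact: measurable_itv.
by apply/seteqP; split => z /= H i; [move=> _; exact: H|exact: H].
Qed.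

Lemma pareto_cube_tail m rho : (0 < m)%N -> 0 <= rho ->
  (0 < Pi m (~` cube m rho))%E /\
  (Pi m (~` cube m rho) <= (m%:R * (1 + rho) `^ (- alpha))%:E)%E.
Proof.
move=> m0 rho0; set x := (1 + rho) `^ (- alpha).
have x0 : 0 < x by rewrite powR_gt0// ltr_pwDl.
have tail : P [set x | rho < x] = x%:E by exact: P_tail.
have mtail : measurable [set x : measurableTypeR R | rho < x].
  by rewrite -set_itvoy; exact: measurable_itv.
have x1 : x <= 1 by rewrite -lee_fin -tail probability_le1.
have Pc : P [set x | x <= rho] = (1 - x)%:E.
  rewrite EFinB -tail -probability_setC//; congr (P _).
  by apply/seteqP; split => y /=; rewrite leNgt => /negP.
have Pi1 : Pi m setT = 1%E.
  by apply: power_measure_setT; exact: probability_setT.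
have Picube : Pi m (cube m rho) = ((1 - x) ^+ m)%:E.
  rewrite (@power_measure_box _ _ _ P m (fun _ => [set x | x <= rho])).
    rewrite (eq_bigr (fun=> (1 - x)%:E))//.
    by rewrite big_const_ord; elim: {+}m => [//|n IH]; rewrite iterS IH exprS.
  move=> _; rewrite (_ : [set _ | _] = ~` [set x | rho < x]).
    exact: measurableC.
  by apply/seteqP; split => y /=; rewrite leNgt => /negP.
have -> : Pi m (~` cube m rho) = (1 - (1 - x) ^+ m)%:E.
  have Pi1y : (Pi m setT < +oo)%E by rewrite Pi1 ltry.
  have -> : Pi m (~` cube m rho) = (Pi m setT - Pi m (setT `&` cube m rho))%E.
    by rewrite -setTD; exact: measureD measurableT (measurable_cube m rho) Pi1y.
  by rewrite setTI Pi1 Picube.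
rewrite lte_fin lee_fin subr_gt0; split.
  by rewrite exprn_ilt1 ?subr_ge0// -?lt0n// gtrBl.
by have := one_sub_muln_le_expr x m (ltW x0) x1; lra.
Qed.

Definition scale_col {d m} (A : 'M[R]_(d, m)) (j : 'I_m) (t : R) :
    'M[R]_(d, m) :=
  \matrix_(i, j') ((if j' == j then t else 1) * A i j').

Lemma mx_act_scale_col d m (A : 'M[R]_(d, m)) (j : 'I_m) (t : R) z :
  mx_act (scale_col A j t) z = mx_act A (scale_coord j t z).
Proof.
apply: eq_from_tnth => i; rewrite !tnth_mktuple !mxE.
apply: eq_bigr => j' _; rewrite !mxE tnth_mktuple.
by case: ifP => _; [rewrite mulrAC mulrC|rewrite mul1r].
Qed.

(** Q0 is the product Pareto law and Q1 has density q with respect to it, where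
    q is the tilt of the weight r that undoes the dilation of coordinate j.  If q
    were r everywhere the two laws of X would coincide, so q against r is all
    that the chi-square distance sees. *)
Lemma exists_dominated_pair d m (A : 'M[R]_(d, m)) (j : 'I_m) s xi zeta (k : nat)
    (th e : R) (rho := zeta * k%:R `^ ((1 - 2 * s) / alpha) / m%:R) :
  0 <= zeta -> 0 <= e -> e <= 2^-1 -> e <= xi * k%:R `^ (- s) ->
  2 * ((alpha + 1) * `|th|) <= e ->
  exists Q0 : probability 'V[R]_m R, exists Q1 : probability 'V[R]_m R,
  [/\ noise_class alpha s xi zeta k Q0, noise_class alpha s xi zeta k Q1 &
      l2_dominated (1 + 8 * e ^+ 2 * (m%:R * (1 + rho) `^ (- alpha)))
        (law (scale_col A j (expR th)) Q1) (law A Q0)].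
Proof.
move=> zeta0 e0 e2 exi the.
have al0 := alpha_gt0.
have m0 : (0 < m)%N by case: m j {A rho} => // -[].
have rho0 : 0 <= rho by rewrite /rho divr_ge0// mulr_ge0// powR_ge0.
have [tail0 tail_le] := pareto_cube_tail m rho m0 rho0.
set t := expR th.
have t0 : 0 < t by exact: expR_gt0.
pose r (z : 'V[R]_m) := scale_weight alpha t (tnth z j).
have mr : measurable_fun [set: 'V[R]_m] r.
  apply: (measurableT_comp (measurable_scale_weight alpha _ t0)).
  exact: measurable_tnth.
have re z : `|r z - 1| <= e.
  rewrite (le_trans _ the)// scale_weight_close//; lra.
have Pi1 : Pi m setT = 1%E.
  by apply: power_measure_setT; exact: probability_setT.
have Icst : (\int[Pi m]_z cst 1%E z = 1)%E.
  by rewrite integral_cst// mul1e; exact: Pi1.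
have r1 : (\int[Pi m]_z (r z)%:E = 1)%E.
  have := integral_scale_coord m j t (cst 1%E) t0 (measurable_cst _)
    (fun _ => lee01).
  rewrite Icst => ->.
  by apply: eq_integral => z _; rewrite mul1e.
have r0 z : 0 < r z by have := re z; rewrite ler_norml => /andP[? ?]; lra.
have [q [c [mq qe qc q1 qr]]] := exists_tilt (Pi m) r (cube m rho) e
  Pi1 (measurable_cube m rho) mr e0 e2 re r1 tail0.
have q0 z : 0 <= q z by have := qe z; rewrite ler_norml => /andP[? ?]; lra.
have outside z : orthant z -> zeta * k%:R `^ ((1 - 2 * s) / alpha) < l1norm z ->
    ~ cube m rho z.
  move=> z0 + zc; apply/negP; rewrite -leNgt /l1norm.
  apply: (@le_trans _ _ (\sum_(i < m) rho)).
    by apply: ler_sum => i _; rewrite ger0_norm//; exact: zc.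
  by rewrite sumr_const card_ord -[_ *+ m]mulr_natr divfK// pnatr_eq0 -lt0n.
have [Q0 nQ0 Q0E] : exists2 Q : probability 'V[R]_m R,
    noise_class alpha s xi zeta k Q &
    forall F : 'V[R]_m -> \bar R, measurable_fun [set: 'V[R]_m] F ->
      (forall z, (0 <= F z)%E) ->
      (\int[Q]_z F z = \int[Pi m]_z (F z * (1:R)%:E))%E.
  apply: (@exists_noise_law m s xi zeta k (cst 1) 1) => //.
  - by move=> z; rewrite subrr normr0 (le_trans e0).
have [Q1 nQ1 Q1E] : exists2 Q : probability 'V[R]_m R,
    noise_class alpha s xi zeta k Q &
    forall F : 'V[R]_m -> \bar R, measurable_fun [set: 'V[R]_m] F ->
      (forall z, (0 <= F z)%E) ->
      (\int[Q]_z F z = \int[Pi m]_z (F z * (q z)%:E))%E.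
  apply: (@exists_noise_law m s xi zeta k q c) => //.
  - by move=> z; rewrite (le_trans (qe z)).
  - by move=> z z0 zz; apply: qc; exact: outside.
exists Q0, Q1; split => // F mF F0.
have mA := measurable_mx_act A.
have mFA : measurable_fun [set: 'V[R]_m] (F \o mx_act A).
  exact: (measurableT_comp mF mA).
have mFAD : measurable_fun [set: 'V[R]_m] (F \o mx_act A \o scale_coord j t).
  exact: (measurableT_comp mFA (measurable_scale_coord _ _ _)).
have mFF : measurable_fun [set: 'V[R]_m] ((F \* F)%E \o mx_act A).
  by apply: (measurableT_comp _ mA); exact: emeasurable_funM.
rewrite /law /distribution !ge0_integral_pushforward//; last 2 first.
- exact: emeasurable_funM.
- by move=> z _; rewrite mule_ge0.
rewrite !preimage_setT.
rewrite (eq_integral (F \o mx_act A \o scale_coord j t)); last first.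
  by move=> z _ /=; rewrite mx_act_scale_col.
rewrite Q1E//; last by move=> z; exact: F0.
have FF0 z : (0 <= ((F \* F) \o mx_act A) z)%E by rewrite /= mule_ge0.
rewrite (Q0E _ mFF FF0).
rewrite (eq_integral ((F \* F)%E \o mx_act A)
  (fun z => (((F \* F)%E \o mx_act A) z * _)%E)); last first.
  by move=> z _; rewrite mule1.
(* Expressing int F^2 under the first law through the dilated coordinate makes
   both integrals range over F (A (D z)), as Cauchy-Schwarz requires. *)
rewrite (integral_scale_coord m j t _ t0 mFF FF0).
apply: (weighted_cauchy_schwarz _ (F \o mx_act A \o scale_coord j t) q r) => //.
- by move=> z; exact: F0.
- apply: (le_trans qr).
  rewrite EFinD leeD2l// (EFinM (8 * e ^+ 2)) lee_wpmul2l//.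
  by rewrite lee_fin mulr_ge0// sqr_ge0.
- rewrite lte_fin ltr_wpDr// mulr_ge0 ?mulr_ge0 ?sqr_ge0//.
  by rewrite powR_ge0.
- exact: ltry.
Qed.

End pareto_noise.

(** * Wasserstein distance and the mass of balls *)

Section wasserstein_ball.
Context {R : realType} {d : nat}.

Lemma l1dist_ge0 (x y : 'V[R]_d) : 0 <= l1dist x y.
Proof. by apply: sumr_ge0. Qed.

Lemma l1dist_eq0 (x y : 'V[R]_d) : (l1dist x y == 0) = (x == y).
Proof.
apply/idP/eqP => [|->]; last first.
  by rewrite /l1dist big1// => i _; rewrite subrr normr0.
rewrite psumr_eq0// => /allP h; apply: eq_from_tnth => i.
by apply/eqP; rewrite -subr_eq0 -normr_eq0; exact/h/mem_index_enum.
Qed.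

Lemma l1distC (x y : 'V[R]_d) : l1dist x y = l1dist y x.
Proof. by apply: eq_bigr => i _; rewrite distrC. Qed.

Lemma l1dist_triangle (x y w : 'V[R]_d) : l1dist x w <= l1dist x y + l1dist y w.
Proof.
rewrite /l1dist -big_split/=; apply: ler_sum => i _.
by rewrite (le_trans _ (ler_normD _ _))// addrA subrK.
Qed.

Definition l1ball (w : 'V[R]_d) (a : R) : set 'V[R]_d := [set y | l1dist y w < a].

Lemma measurable_l1dist {d'} {T : measurableType d'} (f g : T -> 'V[R]_d) :
  measurable_fun setT f -> measurable_fun setT g ->
  measurable_fun setT (fun t => l1dist (f t) (g t)).
Proof.
move=> mf mg; apply: measurable_sum => i.
apply: measurableT_comp => //.
by apply: measurable_funB;
  [exact: (measurableT_comp (measurable_tnth i) mf)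
  |exact: (measurableT_comp (measurable_tnth i) mg)].
Qed.

Lemma measurable_l1ball w a : measurable (l1ball w a).
Proof.
rewrite -[X in measurable X]setTI.
rewrite (_ : l1ball w a = (fun y => l1dist y w) @^-1` `]-oo, a[%classic);
  last first.
  by apply/seteqP; split => y; rewrite /l1ball/= in_itv.
by apply: (measurable_l1dist id (cst w)) => //.
Qed.

(** Markov's inequality for the transport cost on the event A minus B. *)
Lemma transport_markov (A B : set ('V[R]_d * 'V[R]_d)) (h p : R)
    (g : probability ('V[R]_d * 'V[R]_d)%type R) :
  0 <= p -> 0 <= h -> measurable A -> measurable B ->
  (forall y, A y -> ~ B y -> h <= l1dist y.1 y.2) ->
  ((h `^ p)%:E * g A <=
   (h `^ p)%:E * g B + \int[g]_y (l1dist y.1 y.2 `^ p)%:E)%E.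
Proof.
move=> p0 h0 mA mB AB.
set c := h `^ p; have c0 : 0 <= c by exact: powR_ge0.
have mcost : measurable_fun setT
    (fun y : 'V[R]_d * 'V[R]_d => l1dist y.1 y.2 `^ p).
  apply: (measurableT_comp (measurable_powR _)).
  exact: measurable_l1dist.
have mI (D : set ('V[R]_d * 'V[R]_d)) : measurable D ->
    measurable_fun setT (fun y => c%:E * (\1_D y)%:E)%E.
  by move=> mD; apply: measurable_funeM; apply/measurable_EFinP.
have gE D : measurable D -> (c%:E * g D = \int[g]_y (c%:E * (\1_D y)%:E))%E.
  move=> mD; rewrite ge0_integralZl//; first by rewrite integral_indic// setIT.
  - exact/measurable_EFinP.
rewrite !gE// -ge0_integralD//; first last.
- exact/measurable_EFinP.
- by move=> y _; rewrite lee_fin powR_ge0.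
- exact: mI.
- by move=> y _; rewrite mule_ge0 ?lee_fin.
apply: ge0_le_integral => //.
- by move=> y _; rewrite mule_ge0 ?lee_fin.
- exact: mI.
- by apply: emeasurable_funD; [exact: mI|exact/measurable_EFinP].
move=> y _; rewrite -!EFinM -EFinD lee_fin !indicE.
have P0 := powR_ge0 (l1dist y.1 y.2) p.
case: (boolP (y \in A)) => [/set_mem yA|_]; last first.
  by rewrite mulr0 addr_ge0// mulr_ge0.
rewrite mulr1.
case: (boolP (y \in B)) => [_|yB]; first by rewrite mulr1 lerDl.
rewrite mulr0 add0r; apply: ge0_ler_powR; rewrite ?nnegrE ?l1dist_ge0//.
by apply: AB => //; move: yB; rewrite notin_setE.
Qed.

Lemma coupling_l1ball (mu nu : set 'V[R]_d -> \bar R) (w : 'V[R]_d) (a b p : R)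
    (g : probability ('V[R]_d * 'V[R]_d)%type R) :
  0 <= p -> a <= b -> coupling mu nu g ->
  (((b - a) `^ p)%:E * mu (l1ball w a) <=
     ((b - a) `^ p)%:E * nu (l1ball w b) +
     \int[g]_y (l1dist y.1 y.2 `^ p)%:E)%E /\
  (((b - a) `^ p)%:E * nu (l1ball w a) <=
     ((b - a) `^ p)%:E * mu (l1ball w b) +
     \int[g]_y (l1dist y.1 y.2 `^ p)%:E)%E.
Proof.
move=> p0 ab gc.
have mU := measurable_l1ball w.
have [<- <-] := gc _ (mU a); have [<- <-] := gc _ (mU b).
split; apply: transport_markov; rewrite ?subr_ge0//.
- exact: measurableX.
- exact: measurableX.
- move=> [y1 y2] [/= y1a _] y2b; have {y2b} : b <= l1dist y2 w.
    by rewrite leNgt; apply/negP => yb; apply: y2b.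
  have := l1dist_triangle y2 y1 w; rewrite (l1distC y2 y1).
  by rewrite /l1ball/= in y1a; lra.
- exact: measurableX.
- exact: measurableX.
- move=> [y1 y2] [/= _ y2a] y1b; have {y1b} : b <= l1dist y1 w.
    by rewrite leNgt; apply/negP => yb; apply: y1b.
  have := l1dist_triangle y1 y2 w.
  by rewrite /l1ball/= in y2a; lra.
Qed.

Lemma wasserstein_l1ball (mu nu : set 'V[R]_d -> \bar R) (w : 'V[R]_d)
    (a b p t : R) : 0 < p -> a < b ->
  (wasserstein p mu nu `^ p <= t%:E)%E ->
  mu (l1ball w a) \is a fin_num -> mu (l1ball w b) \is a fin_num ->
  nu (l1ball w a) \is a fin_num -> nu (l1ball w b) \is a fin_num ->
  (b - a) `^ p * fine (mu (l1ball w a)) <=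
    (b - a) `^ p * fine (nu (l1ball w b)) + t /\
  (b - a) `^ p * fine (nu (l1ball w a)) <=
    (b - a) `^ p * fine (mu (l1ball w b)) + t.
Proof.
move=> p0 ab + ma mb na nb.
rewrite /wasserstein -poweRrM mulVf ?gt_eqF//.
set S := [set _ | _ in _].
have S0 : (0 <= ereal_inf S)%E.
  apply: le_ereal_inf_tmp => _ [g _ <-]; apply: integral_ge0 => y _.
  by rewrite lee_fin powR_ge0.
rewrite poweRe1// => St.
suff H (e : R) : 0 < e ->
    (b - a) `^ p * fine (mu (l1ball w a)) <=
      (b - a) `^ p * fine (nu (l1ball w b)) + t + e /\
    (b - a) `^ p * fine (nu (l1ball w a)) <=
      (b - a) `^ p * fine (mu (l1ball w b)) + t + e.
  by split; apply/ler_addgt0Pr => e e0; case: (H e e0).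
move=> e0.
have Sfin : ereal_inf S \is a fin_num.
  by rewrite ge0_fin_numE// (le_lt_trans St)// ltry.
have [_ [g gc <-] gt] := lb_ereal_inf_adherent e0 Sfin.
have {}gt : (\int[g]_y (l1dist y.1 y.2 `^ p)%:E <= (t + e)%:E)%E.
  by rewrite (le_trans (ltW gt))// EFinD leeD2r.
have [h1 h2] := coupling_l1ball _ _ w _ _ _ _ (ltW p0) (ltW ab) gc.
split.
  rewrite -lee_fin -addrA EFinD !EFinM !fineK//.
  by rewrite (le_trans h1)// leeD2l.
rewrite -lee_fin -addrA EFinD !EFinM !fineK//.
by rewrite (le_trans h2)// leeD2l.
Qed.

End wasserstein_ball.

(** * Rescaling one column of a coefficient matrix *)

Section columns.
Context {R : realType} {d m : nat}.
Implicit Types A : 'M[R]_(d, m).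

Lemma mx_col_scale_col A (j j' : 'I_m) (t : R) (i : 'I_d) :
  tnth (mx_col (scale_col A j t) j') i =
  (if j' == j then t else 1) * tnth (mx_col A j') i.
Proof. by rewrite !tnth_mktuple mxE. Qed.

Lemma l1norm_scale_col A (j j' : 'I_m) (t : R) : 0 <= t ->
  l1norm (mx_col (scale_col A j t) j') =
  (if j' == j then t else 1) * l1norm (mx_col A j').
Proof.
move=> t0; rewrite /l1norm mulr_sumr; apply: eq_bigr => i _.
by rewrite mx_col_scale_col normrM; case: ifP => _; rewrite ger0_norm.
Qed.

Lemma spectral_atom_scale_col A (j j' : 'I_m) (t : R) : 0 < t ->
  spectral_atom (scale_col A j t) j' = spectral_atom A j'.
Proof.
move=> t0; apply: eq_from_tnth => i; rewrite !tnth_mktuple mxE.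
rewrite l1norm_scale_col ?ltW//; case: ifP => _; last by rewrite !mul1r.
by rewrite invfM mulrACA divff ?mul1r// gt_eqF.
Qed.

(** If all columns had the same direction, A would have rank at most 1 < d and
    the determinant of A A^T would vanish. *)
Lemma atoms_differ A : (2 <= d)%N -> 0 < JA A ->
  (forall j, 0 < l1norm (mx_col A j)) ->
  exists j0 j1, spectral_atom A j1 != spectral_atom A j0.
Proof.
move=> d2 JA0 np.
case: (pselect (exists j0 j1, spectral_atom A j1 != spectral_atom A j0)) => //.
move=> H.
exfalso; move: JA0; apply/negP; rewrite -leNgt /JA.
have sameE j0 j1 : spectral_atom A j1 = spectral_atom A j0.
  by apply/eqP; apply: contra_notT H => ne; exists j0, j1.
suff -> : \det (A *m A^T) = 0 by rewrite normr0 sqrtr0.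
suff AE : exists c : 'cV[R]_d, exists r : 'rV[R]_m, A = c *m r.
  have [c [r AE']] := AE.
  apply/eqP; have : \rank (A *m A^T) != d.
    rewrite {1}AE' -mulmxA neq_ltn.
    rewrite (leq_ltn_trans (mxrankM_maxl _ _))//.
    by rewrite (leq_ltn_trans (rank_leq_col _)).
  apply: contraNT => det0; apply/eqP/mxrank_unit.
  by rewrite unitmxE unitfE.
case: (pselect (exists j : 'I_m, True)) => [[j _]|noj]; last first.
  exists 0, 0; apply/matrixP => i j; by case: noj; exists j.
exists (\col_i tnth (spectral_atom A j) i), (\row_j' l1norm (mx_col A j')).
apply/matrixP => i j'; rewrite !mxE big_ord1 !mxE (sameE j' j) tnth_mktuple.
by rewrite divfK// gt_eqF.
Qed.

(** Continuity: the determinant of A A^T is a polynomial in the scaling factor. *)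
Lemma JA_scale_col_near A (j : 'I_m) (sigma : R) : 0 < sigma -> sigma < JA A ->
  exists2 e : R, 0 < e &
    forall th, `|th| < e -> sigma <= JA (scale_col A j (expR th)).
Proof.
move=> s0 sJA.
pose Ap : 'M[{poly R}]_(d, m) :=
  \matrix_(i, j') ((if j' == j then 'X else 1) * (A i j')%:P).
pose q : {poly R} := \det (Ap *m Ap^T).
have qE t : \det (scale_col A j t *m (scale_col A j t)^T) = q.[t].
  rewrite -[RHS]/(horner_eval t q) /q -det_map_mx map_mxM -map_trmx.
  suff -> : map_mx (horner_eval t) Ap = scale_col A j t by [].
  apply/matrixP => i j'; rewrite !mxE rmorphM /= /horner_eval hornerC.
  by case: ifP => _; rewrite ?hornerX ?hornerC.
have q1 : sigma ^+ 2 < `|q.[expR 0]|.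
  have := sJA; rewrite /JA => h.
  rewrite -qE expR0 (_ : scale_col A j 1 = A); last first.
    by apply/matrixP => i j'; rewrite mxE if_same mul1r.
  rewrite -[ltRHS]sqr_sqrtr//; rewrite ltrXn2r// ?nnegrE ?ltW//.
have cq : {for 0, continuous (fun th : R => `|q.[expR th]|)}.
  apply: (@continuous_comp _ _ _ (fun th : R => q.[expR th])
    (fun x : R => `|x|)); last exact: norm_continuous.
  apply: (@continuous_comp _ _ _ (@expR R) (horner q)).
    exact: continuous_expR.
  exact: continuous_horner.
have : \forall th \near (0:R), sigma ^+ 2 < `|q.[expR th]|.
  exact: (cvgr_gt _ cq _ q1).
rewrite -nbhs_nearE => /nbhs_ballP[e /= e0 H]; exists e => // th the.
have := H th; rewrite /ball /= sub0r normrN => /(_ the) h.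
have := ler_wsqrtr (ltW h).
by rewrite sqrtr_sqr (ger0_norm (ltW s0)) /JA qE.
Qed.

(** A column of norm at least 1 > l has room to shrink, one of norm less than
    1 < u has room to grow; this fixes the sign of the perturbation. *)
Lemma admissible_direction A (j : 'I_m) (l u sigma : R) :
  0 < l -> l < 1 -> 1 < u -> 0 < sigma -> sigma < JA A ->
  coef_class l u sigma A ->
  exists sg e : R, [/\ `|sg| = 1, 0 < e & forall th, 0 <= th -> th < e ->
    coef_class l u sigma (scale_col A j (expR (sg * th)))].
Proof.
move=> l0 l1 u1 s0 sJA [A0 Alu _].
have [e e0 He] := JA_scale_col_near A j sigma s0 sJA.
have u0 : 0 < u by apply: lt_trans u1.
suff [sg [e' [sg1 e'0 H]]] : exists sg e' : R, [/\ `|sg| = 1, 0 < e' &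
    forall th, 0 <= th -> th < e' ->
    l <= expR (sg * th) * l1norm (mx_col A j) <= u].
  exists sg, (Num.min e e'); split => //; first by rewrite lt_min e0.
  move=> th th0; rewrite lt_min => /andP[the the']; split.
  - move=> i j'; rewrite mxE mulr_ge0//; case: ifP => _ //; exact: expR_ge0.
  - move=> j'; rewrite l1norm_scale_col ?expR_ge0//.
    by case: eqP => [->|_]; [exact: H|rewrite mul1r].
  - by apply: He; rewrite normrM sg1 mul1r ger0_norm.
have /andP[Al Au] := Alu j; set N := l1norm _ in Al Au *.
have [N1|N1] := leP 1 N.
  exists (-1), (- ln l); split; first by rewrite normrN1.
    by rewrite oppr_gt0 ln_lt0// l0.
  move=> th th0 the; rewrite mulN1r; apply/andP; split.
    apply: (@le_trans _ _ (expR (- th) * 1)); last by rewrite ler_pM2l ?expR_gt0.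
    by rewrite mulr1 -[leLHS]lnK ?posrE// ler_expR; lra.
  apply: le_trans Au; rewrite ler_piMl ?(le_trans _ N1)//.
  by rewrite -expR0 ler_expR oppr_le0.
exists 1, (ln u); split; first by rewrite normr1.
  by rewrite ln_gt0.
move=> th th0 the; rewrite mul1r; apply/andP; split.
  rewrite (le_trans Al)// ler_peMl ?(le_trans (ltW l0))//.
  by rewrite -expR0 ler_expR.
apply: (@le_trans _ _ (expR th * 1)); first by rewrite ler_pM2l ?expR_gt0 ?ltW.
by rewrite mulr1 -[leRHS]lnK ?posrE// ler_expR ltW.
Qed.

End columns.

(** * Separation of the spectral measures *)

Section spectral_gap.
Context {R : realType} {d m : nat}.
Variable alpha : R.
Implicit Types A : 'M[R]_(d, m).

Lemma spectral_measureE A (B : set 'V[R]_d) :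
  spectral_measure alpha A B =
  (\sum_(j < m | spectral_atom A j \in B) spectral_weight alpha A j)%:E.
Proof.
rewrite /spectral_measure -sumEFin [RHS]big_mkcond/=; apply: eq_bigr => j _.
by rewrite diracE; case: (_ \in B); rewrite ?mule1 ?mule0.
Qed.

Lemma atoms_separated A (w : 'V[R]_d) : exists2 r : R, 0 < r &
  forall j, spectral_atom A j != w -> r <= l1dist (spectral_atom A j) w.
Proof.
exists (\big[Num.min/1]_(j < m | spectral_atom A j != w)
  l1dist (spectral_atom A j) w).
  apply: lt_bigmin => // j jw.
  by rewrite lt_neqAle l1dist_ge0 andbT eq_sym l1dist_eq0.
by move=> j jw; exact: bigmin_le_cond.
Qed.

Definition mass_at (w : 'V[R]_d) A : R :=
  \sum_(j < m | spectral_atom A j == w) l1norm (mx_col A j) `^ alpha.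

Definition mass_off (w : 'V[R]_d) A : R :=
  \sum_(j < m | spectral_atom A j != w) l1norm (mx_col A j) `^ alpha.

Lemma spectral_measure_l1ball A (w : 'V[R]_d) (r a : R) :
  (forall j, spectral_atom A j != w -> r <= l1dist (spectral_atom A j) w) ->
  0 < a -> a <= r ->
  spectral_measure alpha A (l1ball w a) =
  (mass_at w A / (mass_at w A + mass_off w A))%:E.
Proof.
move=> sep a0 ar; rewrite spectral_measureE /spectral_weight -mulr_suml.
rewrite [X in _ / X](bigID (fun j => spectral_atom A j == w)) /=.
congr (_ / _)%:E; apply: eq_bigl => j; apply/idP/idP => [/set_mem/= jw|/eqP jw].
  by apply: contraTT jw => /sep rj; rewrite /l1ball/= -leNgt (le_trans ar).
by apply/mem_set; rewrite /l1ball/= jw (eqP (_ : l1dist w w == 0))// l1dist_eq0.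
Qed.

End spectral_gap.

Lemma expR_sub1_ge {R : realType} (x : R) :
  `|x| <= 2^-1 -> `|x| <= 2 * `|expR x - 1|.
Proof.
move=> x2; have e0 := expR_gt0 x.
have h := expR_ge1Dx x; have h' := expR_ge1Dx (- x); rewrite expRN in h'.
have h2 : (1 - x) * expR x <= 1 by rewrite -ler_pdivlMr// mul1r.
have [x0|x0] := leP 0 x.
  have e1 : 0 <= expR x - 1 by lra.
  by rewrite (ger0_norm x0) (ger0_norm e1); lra.
have e1 : expR x - 1 <= 0 by rewrite subr_le0 -expR0 ler_expR ltW.
move: x2; rewrite (ltr0_norm x0) (ler0_norm e1) => x2; nra.
Qed.

(** X and Z stand for the masses at and off the atom before normalization, x for
    the contribution of one column and T for the factor by which it changes. *)
Lemma perturbed_ratio_gap {R : realType} (X Z x T : R) :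
  0 < x -> x <= X -> 0 < Z -> 0 <= T -> T <= 2 ->
  Z * x / (2 * (X + Z) ^+ 2) * `|T - 1| <=
  `|X / (X + Z) - (X + (T - 1) * x) / (X + (T - 1) * x + Z)|.
Proof.
move=> x0 xX Z0 T0 T2.
have X0 : 0 < X by lra.
have p1 : 0 < X + Z by lra.
have p2 : 0 < X + (T - 1) * x + Z by nra.
rewrite (_ : X / (X + Z) - _ =
  (1 - T) * (Z * x / ((X + Z) * (X + (T - 1) * x + Z)))).
  rewrite normrM distrC mulrC ler_wpM2l// ger0_norm; last first.
    by rewrite divr_ge0// ?mulr_ge0// ltW.
  rewrite ler_pM2l ?mulr_gt0// lef_pV2 ?posrE ?mulr_gt0// ?exprn_gt0//.
  have hx : (T - 1) * x <= 1 * x by rewrite (ler_wpM2r (ltW x0))//; lra.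
  rewrite expr2 mulrCA ler_pM2l//; lra.
by field; rewrite !gt_eqF.
Qed.

Section column_perturbation_gap.
Context {R : realType} {d m : nat}.
Variable alpha : R.
Implicit Types A : 'M[R]_(d, m).

(** Let r separate w from the other atoms.  The balls of radius r / 3 and r
    around w have the same mass for either spectral measure, and the ball of radius
    2 r / 3 has nearly that mass under nu whenever nu is close to it; the masses
    of the two spectral measures at w are therefore close to each other. *)
Lemma spectral_gap A (p : R) (j0 j1 : 'I_m) : 0 < alpha -> 0 < p ->
  (forall j, 0 < l1norm (mx_col A j)) ->
  spectral_atom A j1 != spectral_atom A j0 ->
  exists2 g : R, 0 < g & forall th (nu : probability 'V[R]_d R) (b : R),
    alpha * `|th| <= 2^-1 ->
    (wasserstein p nu (spectral_measure alpha A) `^ p <= b%:E)%E ->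
    (wasserstein p nu (spectral_measure alpha (scale_col A j0 (expR th))) `^ p
      <= b%:E)%E ->
    g * `|th| <= b.
Proof.
move=> al0 p0 np j01.
set w := spectral_atom A j0 in j01.
have [r r0 sep] := atoms_separated A w.
have Np j : 0 < l1norm (mx_col A j) `^ alpha by exact: powR_gt0.
pose X := mass_at alpha w A; pose Z := mass_off alpha w A.
pose x := l1norm (mx_col A j0) `^ alpha.
have x0 : 0 < x by exact: Np.
have xX : x <= X.
  by rewrite /X /mass_at (bigD1 j0)//= lerDl sumr_ge0// => j _; exact: ltW.
have Z0 : 0 < Z.
  by rewrite /Z /mass_off (bigD1 j1)//= ltr_pwDl// sumr_ge0// => j _; exact: ltW.
pose h := (r / 3) `^ p.
have h0 : 0 < h by rewrite powR_gt0// divr_gt0.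
exists (h / 2 * (Z * x / (2 * (X + Z) ^+ 2)) * (alpha / 2)).
  have XZ : 0 < (X + Z) ^+ 2 by rewrite exprn_gt0//; lra.
  by rewrite mulr_gt0 ?divr_gt0// mulr_gt0 ?divr_gt0// mulr_gt0.
move=> th nu b th2 W0 W1.
set A1 := scale_col A j0 (expR th) in W1.
have t0 := expR_gt0 th.
have at1 j : spectral_atom A1 j = spectral_atom A j.
  exact: spectral_atom_scale_col.
have sep1 j : spectral_atom A1 j != w -> r <= l1dist (spectral_atom A1 j) w.
  by rewrite at1; exact: sep.
pose T := expR (alpha * th).
have X1 : mass_at alpha w A1 = X + (T - 1) * x.
  rewrite /X /mass_at (bigD1 j0) ?at1//= [in RHS](bigD1 j0)//=.
  rewrite l1norm_scale_col ?ltW// eqxx powRM ?ltW//.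
  rewrite -expRM [th * _]mulrC -/T -/x.
  rewrite (eq_big (fun j => (spectral_atom A j == w) && (j != j0))
    (fun j => l1norm (mx_col A j) `^ alpha)); first by ring.
    by move=> j; rewrite at1.
  by move=> j /andP[_ /negbTE jj0]; rewrite l1norm_scale_col ?ltW// jj0 mul1r.
have Z1 : mass_off alpha w A1 = Z.
  apply: eq_big => [j|j jw]; first by rewrite at1.
  rewrite l1norm_scale_col ?ltW//; case: eqP => [jj0|_]; last by rewrite mul1r.
  by move: jw; rewrite at1 jj0 eqxx.
have gap (B : 'M[R]_(d, m)) :
    (forall j, spectral_atom B j != w -> r <= l1dist (spectral_atom B j) w) ->
    (wasserstein p nu (spectral_measure alpha B) `^ p <= b%:E)%E ->
    `|h * fine (nu (l1ball w (2 * (r / 3)))) -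
      h * (mass_at alpha w B / (mass_at alpha w B + mass_off alpha w B))| <= b.
  move=> sepB WB.
  have KE a : 0 < a -> a <= r -> spectral_measure alpha B (l1ball w a) =
    (mass_at alpha w B / (mass_at alpha w B + mass_off alpha w B))%:E.
    exact: spectral_measure_l1ball.
  have nufin a : nu (l1ball w a) \is a fin_num.
    by apply: fin_num_measure; exact: measurable_l1ball.
  have a3 : 0 < r / 3 by rewrite divr_gt0.
  have a3r : r / 3 <= r by clear - r0; lra.
  have a23r : 2 * (r / 3) <= r by clear - r0; lra.
  have a23 : 0 < 2 * (r / 3) by clear - r0; lra.
  have lt1 : r / 3 < 2 * (r / 3) by clear - r0; lra.
  have lt2 : 2 * (r / 3) < r by clear - r0; lra.
  have [_] := wasserstein_l1ball _ _ w _ _ _ _ p0 lt1 WB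
    (nufin _) (nufin _) ltac:(by rewrite KE) ltac:(by rewrite KE).
  have [+ _] := wasserstein_l1ball _ _ w _ _ _ _ p0 lt2 WB
    (nufin _) (nufin _) ltac:(by rewrite KE) ltac:(by rewrite KE).
  rewrite (_ : r - 2 * (r / 3) = r / 3); last by field.
  rewrite (_ : 2 * (r / 3) - r / 3 = r / 3); last by field.
  rewrite !KE//= -/h => h1 h2.
  by rewrite ler_norml; apply/andP; split; clear - h1 h2; lra.
have g0 := gap _ sep W0; have g1 := gap _ sep1 W1.
move: g0 g1; rewrite X1 Z1 -/X -/Z.
set K0 := X / _; set K1 := (_ / (_ + Z)); set v := h * fine _ => g0 g1.
have g01 : h * `|K0 - K1| <= 2 * b.
  have -> : h * `|K0 - K1| = `|h * (K0 - K1)| by rewrite normrM (gtr0_norm h0).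
  rewrite (_ : h * (K0 - K1) = (v - h * K1) - (v - h * K0)); last by ring.
  by rewrite (le_trans (ler_normB _ _))//; lra.
have ath : `|alpha * th| <= 2^-1 by rewrite normrM gtr0_norm.
have T1 := expR_sub1_ge _ ath.
have T2 : T <= 2.
  have [th0|th0] := leP 0 (alpha * th).
    have := expR_sub1_le _ th0; rewrite -/T ger0_norm// in ath *.
    by move=> /(_ ath); clear - ath; lra.
  have : T <= 1 by rewrite -expR0 ler_expR ltW.
  clear; lra.
have RG := perturbed_ratio_gap X Z x T x0 xX Z0 (ltW (expR_gt0 _)) T2.
rewrite -/T normrM (gtr0_norm al0) in T1.
set c := Z * x / _ in RG *.
have c0 : 0 <= c by rewrite divr_ge0 ?(ltW (mulr_gt0 Z0 x0))// mulr_ge0// sqr_ge0.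
have s1 : c * (alpha * `|th|) <= 2 * `|K0 - K1|.
  apply: (@le_trans _ _ (c * (2 * `|T - 1|))); first by rewrite ler_wpM2l.
  by rewrite mulrCA ler_pM2l.
have s2 : h * (c * (alpha * `|th|)) <= h * (2 * `|K0 - K1|) by rewrite ler_pM2l.
rewrite (_ : h / 2 * c * (alpha / 2) * `|th| =
  (h * (c * (alpha * `|th|))) / 4); last by field.
clear - s2 g01; lra.
Qed.

End column_perturbation_gap.

(** * The lower bound *)

Lemma limn_einf_gt {R : realType} (u : (\bar R)^nat) (a : \bar R) :
  (a < limn_einf u)%E -> exists N, forall n, (N <= n)%N -> (a < u n)%E.
Proof.
rewrite limn_einf_lim => au.
have cu : einfs u @ \oo --> limn (einfs u) by exact: is_cvg_einfs.
have : \forall n \near \oo, (a < einfs u n)%E.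
  exact: (cu _ (open_nbhs_nbhs (conj (@open_ereal_gt_ereal _ a) au))).
move=> [N _ /(_ N (leqnn N))] /= aN; exists N => n Nn.
by rewrite (lt_le_trans aN)//; apply: ereal_inf_lbound; exists n.
Qed.

Lemma limn_einf_ge {R : realType} (u : (\bar R)^nat) (a : \bar R) N :
  (forall n, (N <= n)%N -> (a <= u n)%E) -> (a <= limn_einf u)%E.
Proof.
move=> au; rewrite limn_einf_lim; apply: lime_ge; first exact: is_cvg_einfs.
exists N => // n /= Nn; apply: le_ereal_inf_tmp => _ [k /= nk <-].
by apply: au; exact: leq_trans nk.
Qed.

(** The powers of n match: (n^(-s))^2 from the squared perturbation times
    (n^((1 - 2 s) / alpha))^(-alpha) from the tail is 1 / n.  This balance
    between the radius of the free region and the admissible relative error is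
    why the two laws stay indistinguishable from n observations. *)
Lemma tail_constant_le {R : realType} (m n : nat) (alpha s zeta E : R) :
  (0 < m)%N -> (0 < n)%N -> 0 < alpha -> 0 < zeta ->
  1 + 8 * (E * n%:R `^ (- s)) ^+ 2 *
    (m%:R * (1 + zeta * n%:R `^ ((1 - 2 * s) / alpha) / m%:R) `^ (- alpha)) <=
  1 + 8 * E ^+ 2 * (m%:R * (zeta / m%:R) `^ (- alpha)) / n%:R.
Proof.
move=> m0 n0 alpha_gt0 zeta_gt0.
have mR0 : 0 < m%:R :> R by rewrite ltr0n.
have nR0 : 0 < n%:R :> R by rewrite ltr0n.
set e := E * _.
rewrite lerD2l; set rho := zeta * _ / _.
have rho0 : 0 < rho by rewrite divr_gt0// mulr_gt0// powR_gt0.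
have rhoE : rho `^ (- alpha) = (zeta / m%:R) `^ (- alpha) * n%:R `^ (2 * s - 1).
  have zm0 : 0 <= zeta / m%:R by rewrite divr_ge0// ltW.
  rewrite /rho mulrAC (@powRM _ (zeta / m%:R)) ?powR_ge0//.
  rewrite -powRrM; congr (_ * _ `^ _); field; exact: lt0r_neq0.
have rho1 : (1 + rho) `^ (- alpha) <= rho `^ (- alpha).
  rewrite !powRN lef_pV2 ?posrE ?powR_gt0 ?addr_gt0//.
  by apply: ge0_ler_powR; rewrite ?nnegrE ?(ltW rho0) ?(ltW alpha_gt0)
    ?(ltW (addr_gt0 ltr01 rho0))// lerDr.
apply: (@le_trans _ _ (8 * e ^+ 2 * (m%:R * rho `^ (- alpha)))).
  apply: ler_wpM2l; last by rewrite ler_pM2l.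
  by apply: mulr_ge0 => //; exact: sqr_ge0.
have nE : (n%:R `^ (- s)) ^+ 2 * n%:R `^ (2 * s - 1) = (n%:R)^-1 :> R.
  rewrite expr2 -!powRD ?(gt_eqF nR0) ?implybT// -powR_inv1 ?ltW//.
  by congr (_ `^ _); ring.
rewrite rhoE /e exprMn -nE le_eqVlt; apply/orP; left; apply/eqP; ring.
Qed.

Theorem theorem3p2 (R : realType) (d m : nat)
  (alpha p l u sigma s xi zeta : R)
  (d_ge2 : (2 <= d)%N) (d_le_m : (d <= m)%N)
  (alpha_gt0 : 0 < alpha) (p_ge1 : 1 <= p)
  (l_gt0 : 0 < l) (l_lt1 : l < 1) (u_gt1 : 1 < u)
  (sigma_gt0 : 0 < sigma)
  (s_gt0 : 0 < s) (s_lt : s < 2^-1)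
  (xi_gt0 : 0 < xi) (xi_lt1 : xi < 1) (zeta_gt0 : 0 < zeta)
  (sigma_nondegenerate :
    exists2 A : 'M[R]_(d, m), coef_class l u sigma A & sigma < JA A)
  (beta : nat -> R) (beta_gt0 : forall n, 0 < beta n)
  (Khat : forall n : nat,
     n.-tuple 'V[R]_d -> probability 'V[R]_d R)
  (Khat_simplex : forall n x, Khat n x (@simplex R d) = 1%E)
  (Khat_measurable : forall n (A : 'M[R]_(d, m)), coef_class l u sigma A ->
     measurable (success alpha p (beta n) (Khat n) A))
  (Khat_rate :
    limn_einf (fun n : nat =>
      ereal_inf [set power_measure (law AQ.1 AQ.2) n
                       (success alpha p (beta n) (Khat n) AQ.1)
                | AQ in @model R d m alpha l u sigma s xi zeta]) = 1%E) :
  (0 < limn_einf (fun n : nat => (n%:R `^ s * beta n `^ p)%:E))%E.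
Proof.
have [A cA sJA] := sigma_nondegenerate.
have np j : 0 < l1norm (mx_col A j).
  by case: cA => _ /(_ j)/andP[lj _] _; exact: lt_le_trans lj.
have p_gt0 : 0 < p by exact: lt_le_trans p_ge1.
have [j0 [j1 j01]] := atoms_differ A d_ge2 (lt_trans sigma_gt0 sJA) np.
have [sg [del [sg1 del0 Hsg]]] :=
  admissible_direction A j0 l u sigma l_gt0 l_lt1 u_gt1 sigma_gt0 sJA cA.
have [g g0 gapP] := spectral_gap alpha A p j0 j1 alpha_gt0 p_gt0 np j01.
have [P [PE Ptail Pscale]] := exists_pareto_law alpha alpha_gt0.
have a1 : 0 < alpha + 1 by rewrite addr_gt0.
(* |theta| will be kap n^(-s), with kap so small that the tilt respects the
   relative error xi n^(-s) and the rescaled matrix stays admissible. *)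
pose kap := Num.min (Num.min 4^-1 (xi / 2) / (alpha + 1)) (del / 2).
have kap0 : 0 < kap.
  by rewrite !lt_min !divr_gt0// lt_min invr_gt0 ltr0n/= divr_gt0.
have kap_le : (alpha + 1) * kap <= Num.min 4^-1 (xi / 2).
  by rewrite mulrC -ler_pdivlMr// ge_min lexx.
have kap4 : (alpha + 1) * kap <= 4^-1.
  by rewrite (le_trans kap_le)// ge_min lexx.
have kapxi : (alpha + 1) * kap <= xi / 2.
  by rewrite (le_trans kap_le)// ge_min lexx orbT.
have kapdel : kap < del.
  apply: (@le_lt_trans _ _ (del / 2)); first by rewrite ge_min lexx orbT.
  by clear - del0; lra.
pose E := 2 * ((alpha + 1) * kap).
have E0 : 0 <= E by rewrite /E mulr_ge0// ltW// mulr_gt0.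
have m0 : (0 < m)%N by rewrite (leq_trans _ d_le_m)// (leq_trans _ d_ge2).
have mR0 : 0 < m%:R :> R by rewrite ltr0n.
pose K := 8 * E ^+ 2 * (m%:R * (zeta / m%:R) `^ (- alpha)).
(* The two-point inequality would give (1 - eta)^2 <= exp K * eta = 1/4, while
   eta <= 1/4. *)
pose eta := (4 * expR K)^-1.
have K0 : 0 <= K.
  apply: mulr_ge0; first by apply: mulr_ge0 => //; exact: sqr_ge0.
  by apply: mulr_ge0; [exact: ltW|exact: powR_ge0].
have eta0 : 0 < eta by rewrite invr_gt0 mulr_gt0// expR_gt0.
have eta4 : eta <= 4^-1.
  rewrite /eta invfM ger_pMr// invf_le1 ?expR_gt0//.
  by rewrite -expR0 ler_expR.
have [N HN] : exists N, forall n, (N <= n)%N -> ((1 - eta)%:E <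
    ereal_inf [set power_measure (law AQ.1 AQ.2) n
                       (success alpha p (beta n) (Khat n) AQ.1)
                | AQ in @model R d m alpha l u sigma s xi zeta])%E.
  by apply: limn_einf_gt; rewrite Khat_rate lte_fin gtrBl.
apply: (@lt_le_trans _ _ (g * kap)%:E); first by rewrite lte_fin mulr_gt0.
apply: (@limn_einf_ge _ _ _ (maxn N 1)) => n; rewrite geq_max => /andP[Nn n0].
have {HN} := HN n Nn => HN.
have nR0 : 0 < n%:R :> R by rewrite ltr0n.
have nR1 : 1 <= n%:R :> R by rewrite ler1n.
have ns0 : 0 < n%:R `^ (- s) by rewrite powR_gt0.
have ns1 : n%:R `^ (- s) <= 1.
  have := @ler_powR _ _ nR1 (- s) 0; rewrite powRr0; apply.
  by rewrite oppr_le0 ltW.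
pose th := sg * (kap * n%:R `^ (- s)).
have th_abs : `|th| = kap * n%:R `^ (- s).
  by rewrite normrM sg1 mul1r gtr0_norm// mulr_gt0.
have thkap : `|th| <= kap by rewrite th_abs ler_piMr// ltW.
pose e := E * n%:R `^ (- s).
have e0 : 0 <= e by rewrite mulr_ge0// ltW.
have e2 : e <= 2^-1.
  rewrite (@le_trans _ _ E)//; first by rewrite ler_piMr.
  rewrite /E; clear - kap4; lra.
have exi : e <= xi * n%:R `^ (- s).
  by rewrite ler_pM2r// /E; clear - kapxi; lra.
have the : 2 * ((alpha + 1) * `|th|) <= e.
  by rewrite th_abs /e /E !mulrA.
have [Q0 [Q1 [nQ0 nQ1 dom]]] := exists_dominated_pair alpha P alpha_gt0
  (fun B _ => PE B) Ptail Pscale d m A j0 s xi zeta n th e (ltW zeta_gt0)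
  e0 e2 exi the.
set A1 := scale_col A j0 (expR th) in dom.
have cA1 : coef_class l u sigma A1.
  apply: Hsg; first by rewrite mulr_ge0// ltW.
  by rewrite -th_abs (le_lt_trans thkap).
set C := (1 + _) in dom.
have C0 : 0 <= C.
  apply: addr_ge0 => //; apply: mulr_ge0.
    by apply: mulr_ge0 => //; exact: sqr_ge0.
  by apply: mulr_ge0; [exact: ltW|exact: powR_ge0].
have CK : C <= 1 + K / n%:R by exact: tail_constant_le.
have CnK : C ^+ n <= expR K.
  apply: (@le_trans _ _ (expR (K / n%:R) ^+ n)).
    by apply: lerXn2r; rewrite ?nnegrE ?expR_ge0// (le_trans CK)// expR_ge1Dx.
  by rewrite -expRM_natl mulrC divfK ?gt_eqF.
rewrite lee_fin leNgt; apply/negP => small.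
have small' : beta n `^ p < g * `|th|.
  by rewrite th_abs mulrA powRN ltr_pdivlMr ?powR_gt0// mulrC.
pose S0 := success alpha p (beta n) (Khat n) A.
pose S1 := success alpha p (beta n) (Khat n) A1.
have S01 : S0 `&` S1 = set0.
  apply/seteqP; split => x // -[x0 x1].
  have : alpha * `|th| <= 2^-1.
    apply: (@le_trans _ _ (alpha * kap)); first by rewrite ler_wpM2l// ltW.
    clear - kap4 kap0; lra.
  by move=> /gapP /(_ x0 x1); rewrite leNgt small'.
have mem0 : model alpha l u sigma s xi zeta (A, Q0) by exists n.
have mem1 : model alpha l u sigma s xi zeta (A1, Q1) by exists n.
have P0 : ((1 - eta)%:E <= power_measure (law A Q0) n S0)%E.
  apply: (le_trans (ltW HN)); apply: ereal_inf_lbound.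
  by exists (A, Q0).
have P1 : ((1 - eta)%:E <= power_measure (law A1 Q1) n S1)%E.
  apply: (le_trans (ltW HN)); apply: ereal_inf_lbound.
  by exists (A1, Q1).
have tot : power_measure (law A Q0) n setT = 1%E.
  by apply: power_measure_setT; exact: probability_setT.
have := l2_dominated_two_point _ _ _ eta S0 S1 tot (exprn_ge0 n C0) _
  (l2_dominated_power C _ _ n C0 dom) (Khat_measurable n A cA)
  (Khat_measurable n A1 cA1) S01 P0 P1.
have eK : C ^+ n * eta <= 4^-1.
  rewrite /eta invfM mulrCA ger_pMr// ler_pdivrMr ?expR_gt0// mul1r//.
have eta1 : eta <= 1 by rewrite (le_trans eta4)// invf_le1// ler1n.
move=> /(_ eta1) hh; clear - hh eK eta4; nra.
Qed.
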